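(* Let $F$, $x_F^*$, $L$, $\mu$, $\beta$, Algorithm A (AINE) and Algorithm B (restarted distributed AINE) be as defined in the context, with $\mu>0$ and $R_0\ge\|z_0-x_F^*\|$, and with the universal constant $C$ in the stage lengths of Algorithm B sufficiently large. The iterates of Algorithm B satisfy $$\|z_s-x_F^*\|\le R_0\,2^{-s},\qquad F(z_s)-F(x_F^* )\le\frac{\mu R_0^2}{2}\,2^{-2s}.$$ Counting two communication rounds per iteration of Algorithm A, set $$\tau_1=1+C\Big(\frac{LR_0}{\mu}\Big)^{2/7},\qquad \tau_2=1+C\sqrt{\frac{\beta}{\mu}}.$$ For an arbitrary communication budget $T$, let $$S(T)=\Big\lfloor\frac{T}{2\max\{\tau_1,\tau_2\}}\Big\rfloor,\qquad x_T:=z_{S(T)}.$$ Thus $x_T$ is the last completed restart point if the budget expires inside a stage. The iterates satisfy $$\|x_T-x_F^*\|\le 2R_0\exp\Big(-\frac{(\ln 2)\,T}{2\max\{\tau_1,\tau_2\}}\Big).$$ Moreover, reaching $F(z_s)-F(x_F^* )\le\varepsilon$ requires $$T=O\Big(\Big(\frac{LR_0}{\mu}\Big)^{2/7}+\Big(1+\sqrt{\frac{\beta}{\mu}}\Big)\log\frac{\mu R_0^2}{\varepsilon}\Big)$$ communication rounds.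
   Context: **Problem.** $\|\cdot\|$ is the Euclidean norm on $\mathbb{R}^d$ and the spectral norm on matrices. There are $m$ agents, each with $n$ samples, $N=mn$ in total, the samples $\xi^{k,j}$ being iid. For $k=1,\dots,m$ let $f_k(x)=\frac1n\sum_{j=1}^n f(x,\xi^{k,j})$, where for every $\xi$ the function $f(\cdot,\xi):\mathbb{R}^d\to\mathbb{R}$ is convex, sufficiently smooth, $L_0$-Lipschitz, and has $L$-Lipschitz Hessian: $\|\nabla^2f(x,\xi)-\nabla^2f(y,\xi)\|\le L\|x-y\|$. For $\mu>0$ and a fixed center $\bar x\in\mathbb{R}^d$, the empirical objective is $$F(x)=\frac1m\sum_{k=1}^m f_k(x)+\frac\mu2\|x-\bar x\|^2,$$ which is $\mu$-strongly convex; $x_F^*$ is its minimizer. Agent $1$ is the server and the other agents are workers. **Inexact Hessian.** $\beta$ is a bound on the statistical similarity: $\sup_w\big\|\frac1m\sum_{j=1}^m\nabla^2f_j(w)-\nabla^2f_k(w)\big\|\le\beta$ for all $k$ (for iid samples this holds with probability at least $1-\delta$ with $\beta=\widetilde O(\sqrt{LL_0d/n})$). With $H(x)=\nabla^2f_1(x)+\mu I$ one then has $\|H(x)-\nabla^2F(x)\|\le\beta$, i.e. $H(x)$ is a $\beta$-inexact Hessian of $F$ at $x$. **Oracle.** A $\beta$-inexact Monteiro–Svaiter oracle $\mathcal O$ queried at $z$ returns $(y,\lambda)=\mathcal O(z)$ such that $$\|\nabla F(y)+\lambda(y-z)\|\le\frac\lambda2\|y-z\|,\qquad \lambda\ge c\,(\beta+L\|y-z\|),$$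 where $c>0$ is a constant. In the distributed method such an oracle is implemented on the server by the cubic-regularized Newton step $$y=\arg\min_u\Big\{F(z)+\langle\nabla F(z),u-z\rangle+\tfrac12\langle(H(z)+2\beta I)(u-z),u-z\rangle+\tfrac L3\|u-z\|^3\Big\},\qquad \lambda=2\beta+L\|y-z\|.$$ **Algorithm A (AINE).** Input: starting point $x_0$, horizon $t$, an oracle $\mathcal O$ satisfying the two Monteiro–Svaiter conditions above, and a known bound $D_0\ge\frac12\|x_0-x_F^*\|^2$. Initialize $v_0=z_0=x_0$, $A_0=0$, $(y_0,\lambda_0)=\mathcal O(z_0)$. For $j=0,\dots,t-1$: 1. If $j=0$, set $\lambda'_j=\lambda_0$. Else, if $j=1$ or $A_j>2A_r$ (with $r$ the currently stored index), store $r=j$, $A_r=A_j$, and set $\lambda'_j=\Theta\big(\beta+(D_0L^2/A_r^{3/2})^{2/7}\big)$. Otherwise set $\lambda'_j=\lambda'_r$. 2. $a'_{j+1}=\dfrac{1+\sqrt{1+4\lambda'_jA_j}}{2\lambda'_j}$, $A'_{j+1}=A_j+a'_{j+1}$, $z_j=\dfrac{A_jx_j+a'_{j+1}v_j}{A'_{j+1}}$. 3. If $j>0$, $(y_j,\lambda_j)=\mathcal O(z_j)$. 4. $\theta_j=\min\{1,\lambda'_j/\lambda_j\}$, $a_{j+1}=\theta_ja'_{j+1}$, $A_{j+1}=A_j+a_{j+1}$. 5. $x_{j+1}=\dfrac{(1-\theta_j)A_jx_j+\theta_jA'_{j+1}y_j}{A_{j+1}}$, $v_{j+1}=v_j-a_{j+1}\nabla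 F(y_j)$. Output: $x_t$. Each iteration uses two communication rounds: one aggregation of the gradients of the $f_k$ at $z_j$ and one at $y_j$. **Algorithm B (restarted distributed AINE).** Input: $z_0$, $R_0\ge\|z_0-x_F^*\|$, and $\mu>0$. For stages $s=1,2,\dots$: 1. Set $R_{s-1}=R_0/2^{s-1}$ and $D_{0,s}=R_{s-1}^2/2$. 2. Choose $$t_s=\Big\lceil C\max\Big\{\sqrt{\tfrac{\beta}{\mu}},\Big(\tfrac{LR_{s-1}}{\mu}\Big)^{2/7}\Big\}\Big\rceil$$ for a sufficiently large universal constant $C$. 3. Run Algorithm A for $t_s$ iterations with its internal state initialized as $x_0^{(s)}=v_0^{(s)}=z_0^{(s)}=z_{s-1}$, $A_0^{(s)}=0$, and with the bound $D_{0,s}$ in the role of $D_0$; let $z_s=x_{t_s}^{(s)}$ be its output.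
   Formalization: Assumes β>0 or L>0 (otherwise t_s=0), states the gap bound only for s≥1 and the complexity for ε≤μR_0²/2; the oracle is the server's cubic step, returning y_0 if λ_0=0; x_T is shown to be a completed restart point within budget, not the last one. *)

(* Defs.v *)
From HB Require Import structures.
From mathcomp Require Import all_boot all_order all_algebra.
From mathcomp Require Import all_classical all_reals all_analysis.
Import Order.TTheory GRing.Theory Num.Theory.
Import numFieldNormedType.Exports.

Set Implicit Arguments.
Unset Strict Implicit.
Unset Printing Implicit Defensive.

Local Open Scope classical_set_scope.
Local Open Scope ring_scope.

(* The normed-module norm of ['rV[R]_d] is the sup norm; the Euclidean and
   spectral norms are defined here, while differentiability (which does not
   depend on the norm in finite dimension) is the library's. *)
Definition dot (R : realType) (d : nat) (u v : 'rV[R]_d) : R :=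
  \sum_(i < d) u 0 i * v 0 i.

Definition enorm (R : realType) (d : nat) (u : 'rV[R]_d) : R :=
  Num.sqrt (dot u u).

(* Matrices act on row vectors from the right; a matrix and its transpose
   have the same spectral norm. *)
Definition specnorm (R : realType) (d : nat) (A : 'M[R]_d) : R :=
  sup [set enorm (v *m A) | v in [set v : 'rV[R]_d | enorm v <= 1]].

Definition grad (R : realType) (d : nat) (g : 'rV[R]_d -> R) (x : 'rV[R]_d) :
  'rV[R]_d := \row_(i < d) 'D_(delta_mx 0 i) g x.

Definition hess (R : realType) (d : nat) (g : 'rV[R]_d -> R) (x : 'rV[R]_d) :
  'M[R]_d := 'J (grad g) x.

(* Twice (Frechet) differentiable with Lipschitz Hessian, hence C^2. *)
Record regular_loss (R : realType) (d : nat) (L0 L : R) (g : 'rV[R]_d -> R) :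
    Prop := RegularLoss {
  loss_convex : convex_function [set: convex_lmodType 'rV[R]_d] g;
  loss_diff : forall x, differentiable g x;
  loss_diff2 : forall x, differentiable (grad g) x;
  loss_lip : forall x y, `|g x - g y| <= L0 * enorm (x - y);
  loss_hess_lip : forall x y,
    specnorm (hess g x - hess g y) <= L * enorm (x - y) }.

Definition local_loss (R : realType) (d m n : nat) (Xi : Type)
    (f : 'rV[R]_d -> Xi -> R) (xi : 'I_m -> 'I_n -> Xi) (k : 'I_m)
    (x : 'rV[R]_d) : R :=
  n%:R^-1 * \sum_(j < n) f x (xi k j).

Definition objective (R : realType) (d m n : nat) (Xi : Type)
    (f : 'rV[R]_d -> Xi -> R) (xi : 'I_m -> 'I_n -> Xi) (mu : R)
    (xbar : 'rV[R]_d) (x : 'rV[R]_d) : R :=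
  m%:R^-1 * \sum_(k < m) local_loss f xi k x + mu / 2 * enorm (x - xbar) ^+ 2.

Definition similarity_bound (R : realType) (d m n : nat) (Xi : Type)
    (f : 'rV[R]_d -> Xi -> R) (xi : 'I_m -> 'I_n -> Xi) (beta : R) : Prop :=
  forall (k : 'I_m) (w : 'rV[R]_d),
    specnorm (m%:R^-1 *: (\sum_(j < m) hess (local_loss f xi j) w)
              - hess (local_loss f xi k) w) <= beta.

Definition server_hess (R : realType) (d m n : nat) (Xi : Type)
    (f : 'rV[R]_d -> Xi -> R) (xi : 'I_m -> 'I_n -> Xi) (mu : R)
    (server : 'I_m) (x : 'rV[R]_d) : 'M[R]_d :=
  hess (local_loss f xi server) x + mu%:M.

Definition cubic_model (R : realType) (d : nat) (F : 'rV[R]_d -> R)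
    (H : 'rV[R]_d -> 'M[R]_d) (beta L : R) (z u : 'rV[R]_d) : R :=
  F z + dot (grad F z) (u - z)
  + 2^-1 * dot ((u - z) *m (H z + (2 * beta)%:M)) (u - z)
  + L / 3 * enorm (u - z) ^+ 3.

(* The server's implementation of the Monteiro-Svaiter oracle. *)
Definition cubic_oracle (R : realType) (d : nat) (F : 'rV[R]_d -> R)
    (H : 'rV[R]_d -> 'M[R]_d) (beta L : R)
    (O : 'rV[R]_d -> 'rV[R]_d * R) : Prop :=
  forall z, (forall u, cubic_model F H beta L z (O z).1
                       <= cubic_model F H beta L z u)
            /\ (O z).2 = 2 * beta + L * enorm ((O z).1 - z).

(* [st_Ar] is A_r for the stored index r, and [st_lamr] is lambda'_r. *)
Record aine_state (R : realType) (d : nat) := AineState {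
  st_x : 'rV[R]_d; st_v : 'rV[R]_d; st_A : R; st_Ar : R; st_lamr : R }.

(* The factor [kap j] realises the Theta(.) in the choice of lambda'_j.
   If lambda_j = 0 then lambda'_j / lambda_j is read as +oo, so theta_j = 1. *)
Definition aine_step (R : realType) (d : nat) (F : 'rV[R]_d -> R)
    (O : 'rV[R]_d -> 'rV[R]_d * R) (beta L D0 : R) (kap : nat -> R)
    (x0 : 'rV[R]_d) (j : nat) (st : aine_state R d) : aine_state R d :=
  let: AineState x v A Ar lamr := st in
  let: (Ar', lamr') :=
    if (j == 1)%N || ((1 < j)%N && (2 * Ar < A)) then
      (A, kap j * (beta + (D0 * L ^+ 2 / A `^ (3 / 2)) `^ (2 / 7)))
    else (Ar, lamr) in
  let lam' := if (j == 0)%N then (O x0).2 else lamr' in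
  let a' := (1 + Num.sqrt (1 + 4 * lam' * A)) / (2 * lam') in
  let A' := A + a' in
  let z := A'^-1 *: (A *: x + a' *: v) in
  let: (y, lam) := if (j == 0)%N then O x0 else O z in
  let theta := if lam == 0 then 1 else Num.min 1 (lam' / lam) in
  let a := theta * a' in
  let A1 := A + a in
  AineState (A1^-1 *: (((1 - theta) * A) *: x + (theta * A') *: y))
            (v - a *: grad F y) A1 Ar' lamr'.

Fixpoint aine_iter (R : realType) (d : nat) (F : 'rV[R]_d -> R)
    (O : 'rV[R]_d -> 'rV[R]_d * R) (beta L D0 : R) (kap : nat -> R)
    (x0 : 'rV[R]_d) (j : nat) : aine_state R d :=
  if j is i.+1
  then aine_step F O beta L D0 kap x0 i (aine_iter F O beta L D0 kap x0 i)
  else AineState x0 x0 0 0 0.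

(* If lambda_0 = 0 the first step is infinite (A_1 = +oo) and y_0 is already
   the exact minimiser of F; the method then stops and returns y_0. *)
Definition aine (R : realType) (d : nat) (F : 'rV[R]_d -> R)
    (O : 'rV[R]_d -> 'rV[R]_d * R) (beta L D0 : R) (kap : nat -> R)
    (x0 : 'rV[R]_d) (t : nat) : 'rV[R]_d :=
  if (O x0).2 == 0 then (O x0).1 else st_x (aine_iter F O beta L D0 kap x0 t).

Definition radius (R : realType) (R0 : R) (s : nat) : R := R0 / 2 ^+ s.

(* Stages are numbered from 1. *)
Definition stage_len (R : realType) (C mu beta L R0 : R) (s : nat) : nat :=
  `|Num.ceil (C * Num.max (Num.sqrt (beta / mu))
                          ((L * radius R0 s.-1 / mu) `^ (2 / 7)))|%N.

Fixpoint restarted_aine (R : realType) (d : nat) (F : 'rV[R]_d -> R)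
    (O : 'rV[R]_d -> 'rV[R]_d * R) (C mu beta L R0 : R)
    (kap : nat -> nat -> R) (z0 : 'rV[R]_d) (s : nat) : 'rV[R]_d :=
  if s is s'.+1
  then aine F O beta L (radius R0 s' ^+ 2 / 2) (kap s)
            (restarted_aine F O C mu beta L R0 kap z0 s')
            (stage_len C mu beta L R0 s)
  else z0.

Definition comm_rounds (R : realType) (C mu beta L R0 : R) (s : nat) : nat :=
  (\sum_(1 <= i < s.+1) 2 * stage_len C mu beta L R0 i)%N.

(* Main.v *)
(* Let E_j = A_j (F(x_j) - F(xs)) + |v_j - xs|^2 / 2. The Monteiro-Svaiter conditions make E_j
   decrease by at least (3/8) A'_{j+1} min(lambda_j, lambda'_j) |y_j - z_j|^2 per iteration, so
   F(x_t) - F(xs) <= D_0 / A_t and only the growth of A_t matters. Put A_j = u_j^14,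
   h^14 = D_0 L^2, b^2 = beta and Psi(u) = b u^7 + h^2 u^4, that is,
   Psi = sqrt(beta A) + (D_0 L^2)^(1/7) A^(2/7). An iteration whose guess lambda'_j is at worst
   a constant factor below lambda_j raises Psi by a constant. Any other iteration moves far,
   L |y_j - z_j| >= lambda_j / 2, and so spends energy; as E_0 <= D_0, this happens
   O(h^2 u_t^4) times. Hence t = O(Psi(u_t)), so a stage of length t_s forces A_{t_s} >= 4 / mu,
   and strong convexity halves the distance to the minimiser xs.
   That the cubic step satisfies the Monteiro-Svaiter conditions uses the symmetry of the
   Hessian, obtained from second differences and the Lipschitz bound. *)
Require Import Defs.
From HB Require Import structures.
From mathcomp Require Import all_boot all_order all_algebra.
From mathcomp Require Import all_classical all_reals all_analysis.
From mathcomp Require Import ring lra.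
Import Order.TTheory GRing.Theory Num.Theory.
Import numFieldNormedType.Exports.

Set Implicit Arguments.
Unset Strict Implicit.
Unset Printing Implicit Defensive.

Local Open Scope classical_set_scope.
Local Open Scope ring_scope.

(** * Euclidean norm of row vectors and spectral norm of matrices *)

Section Euclid.
Variables (R : realType) (d : nat).
Implicit Types (u v w : 'rV[R]_d) (A B : 'M[R]_d) (a : R).

Lemma dotC u v : dot u v = dot v u.
Proof. by apply: eq_bigr => i _; rewrite mulrC. Qed.

Lemma dotDl u v w : dot (u + v) w = dot u w + dot v w.
Proof. by rewrite -big_split; apply: eq_bigr => i _; rewrite mxE mulrDl. Qed.

Lemma dotZl a u v : dot (a *: u) v = a * dot u v.
Proof. by rewrite mulr_sumr; apply: eq_bigr => i _; rewrite mxE mulrA. Qed.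

Lemma dotNl u v : dot (- u) v = - dot u v.
Proof. by rewrite -scaleN1r dotZl mulN1r. Qed.

Lemma dotDr u v w : dot u (v + w) = dot u v + dot u w.
Proof. by rewrite dotC dotDl !(dotC u). Qed.

Lemma dotZr a u v : dot u (a *: v) = a * dot u v.
Proof. by rewrite dotC dotZl dotC. Qed.

Lemma dotNr u v : dot u (- v) = - dot u v.
Proof. by rewrite dotC dotNl dotC. Qed.

Definition dotE := (dotDl, dotDr, dotNl, dotNr, dotZl, dotZr).

Lemma dot0l u : dot 0 u = 0.
Proof. by rewrite -(scale0r 0) dotZl mul0r. Qed.

Lemma dot0r u : dot u 0 = 0. Proof. by rewrite dotC dot0l. Qed.

Lemma dot_ge0 u : 0 <= dot u u.
Proof. by apply: sumr_ge0 => i _; rewrite -expr2 sqr_ge0. Qed.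

Lemma dot_eq0 u : (dot u u == 0) = (u == 0).
Proof.
apply/eqP/eqP => [h|->]; last by rewrite dot0l.
apply/rowP => i; rewrite mxE; apply/eqP; rewrite -sqrf_eq0 expr2.
move/eqP: h; rewrite psumr_eq0; last by move=> j _; rewrite -expr2 sqr_ge0.
by move/allP/(_ i); rewrite mem_index_enum => /(_ isT).
Qed.

Lemma enorm_ge0 u : 0 <= enorm u. Proof. exact: sqrtr_ge0. Qed.

Lemma enorm_sqr u : enorm u ^+ 2 = dot u u.
Proof. by rewrite sqr_sqrtr ?dot_ge0. Qed.

Lemma enorm_eq0 u : (enorm u == 0) = (u == 0).
Proof. by rewrite -sqrf_eq0 enorm_sqr dot_eq0. Qed.

Lemma enorm0 : enorm (0 : 'rV[R]_d) = 0.
Proof. by apply/eqP; rewrite enorm_eq0. Qed.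

Lemma enormZ a u : enorm (a *: u) = `|a| * enorm u.
Proof. by rewrite /enorm dotZl dotZr mulrA -expr2 sqrtrM ?sqr_ge0// sqrtr_sqr. Qed.

Lemma enormN u : enorm (- u) = enorm u.
Proof. by rewrite -scaleN1r enormZ normrN1 mul1r. Qed.

Lemma enormB u v : enorm (u - v) = enorm (v - u).
Proof. by rewrite -enormN opprB. Qed.

Lemma cauchy_schwarz u v : dot u v <= enorm u * enorm v.
Proof.
have [/eqP|v0] := eqVneq (enorm v) 0.
  by rewrite enorm_eq0 => /eqP ->; rewrite dot0r enorm0 mulr0.
have [/eqP|u0] := eqVneq (enorm u) 0.
  by rewrite enorm_eq0 => /eqP ->; rewrite dot0l enorm0 mul0r.
have vp : 0 < enorm v by rewrite lt_def v0 enorm_ge0.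
have up : 0 < enorm u by rewrite lt_def u0 enorm_ge0.
have := dot_ge0 (enorm v *: u - enorm u *: v).
rewrite !dotE -!enorm_sqr (dotC v u) => h.
have : 0 <= enorm u * enorm v * (enorm u * enorm v - dot u v) by lra.
by rewrite pmulr_rge0 ?mulr_gt0// subr_ge0.
Qed.

Lemma ler_enormD u v : enorm (u + v) <= enorm u + enorm v.
Proof.
rewrite -(@ler_pXn2r _ 2)// ?nnegrE ?addr_ge0 ?enorm_ge0//.
rewrite enorm_sqr !dotE (dotC v u) -!enorm_sqr.
by have := cauchy_schwarz u v; lra.
Qed.

Lemma enorm_sum (I : Type) (r : seq I) (F : I -> 'rV[R]_d) :
  enorm (\sum_(i <- r) F i) <= \sum_(i <- r) enorm (F i).
Proof.
elim/big_ind2 : _ => [|x1 x2 y1 y2 h1 h2|//]; first by rewrite enorm0.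
exact: le_trans (ler_enormD _ _) (lerD h1 h2).
Qed.

Lemma ler_enorm_dist u v : `|enorm u - enorm v| <= enorm (u - v).
Proof.
have h1 := ler_enormD (u - v) v; have h2 := ler_enormD (v - u) u.
by rewrite !subrK (enormB v u) in h1 h2; rewrite ler_norml; lra.
Qed.

Lemma ler_coord_enorm u i : `|u 0 i| <= enorm u.
Proof.
rewrite -(@ler_pXn2r _ 2)// ?nnegrE ?enorm_ge0// real_normK ?num_real//.
rewrite enorm_sqr /dot (bigD1 i)//= -expr2 lerDl.
by apply: sumr_ge0 => j _; rewrite -expr2 sqr_ge0.
Qed.

(** Lower bounds on [specnorm] rest on this, as [sup] is meaningful only on sets bounded above.
    Coordinates on the unit ball are at most 1 in absolute value, so the row norms add up to a
    bound. *)
Lemma specnorm_set_bounded A :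
  has_ubound [set enorm (v *m A) | v in [set v : 'rV[R]_d | enorm v <= 1]].
Proof.
exists (\sum_i enorm (row i A)) => _ [v /= v1 <-].
have le_sum := enorm_sum (index_enum (fintype_ordinal__canonical__fintype_Finite d))
  (fun i => v 0 i *: row i A).
rewrite mulmx_sum_row; apply: (le_trans le_sum).
apply: ler_sum => i _; rewrite enormZ ler_piMl ?enorm_ge0//.
exact: le_trans (ler_coord_enorm _ _) v1.
Qed.

Lemma enorm_mulmx A v : enorm (v *m A) <= specnorm A * enorm v.
Proof.
have [/eqP|v0] := eqVneq (enorm v) 0.
  by rewrite enorm_eq0 => /eqP ->; rewrite mul0mx enorm0 mulr0.
have vp : 0 < enorm v by rewrite lt_def v0 enorm_ge0.
rewrite -ler_pdivrMr//; apply: ub_le_sup; first exact: specnorm_set_bounded.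
exists ((enorm v)^-1 *: v) => /=; last first.
  by rewrite -scalemxAl enormZ ger0_norm ?invr_ge0 ?enorm_ge0// mulrC.
by rewrite enormZ ger0_norm ?invr_ge0 ?enorm_ge0// mulVf.
Qed.

Lemma specnorm_le A (c : R) : 0 <= c ->
  (forall v, enorm (v *m A) <= c * enorm v) -> specnorm A <= c.
Proof.
move=> c0 h; apply: sup_le_ub.
  by exists (enorm (0 *m A)), 0 => //=; rewrite enorm0.
move=> _ [v /= v1 <-]; apply: le_trans (h v) _.
by rewrite -[leRHS]mulr1 ler_wpM2l.
Qed.

Lemma specnorm_ge0 A : 0 <= specnorm A.
Proof.
apply: ub_le_sup; first exact: specnorm_set_bounded.
by exists 0; rewrite /= ?mul0mx enorm0.
Qed.

Lemma specnormD A B : specnorm (A + B) <= specnorm A + specnorm B.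
Proof.
apply: specnorm_le => [|v]; first by rewrite addr_ge0 ?specnorm_ge0.
rewrite mulmxDr mulrDl; apply: le_trans (ler_enormD _ _) _.
by rewrite lerD ?enorm_mulmx.
Qed.

Lemma specnormZ a A : specnorm (a *: A) <= `|a| * specnorm A.
Proof.
apply: specnorm_le => [|v]; first by rewrite mulr_ge0 ?specnorm_ge0.
by rewrite -scalemxAr enormZ -mulrA ler_wpM2l// enorm_mulmx.
Qed.

Lemma specnorm0 : specnorm (0 : 'M[R]_d) = 0.
Proof.
apply/eqP; rewrite eq_le specnorm_ge0 andbT.
by apply: specnorm_le => // v; rewrite mulmx0 enorm0 mul0r.
Qed.

Lemma specnorm_sum (I : Type) (r : seq I) (F : I -> 'M[R]_d) :
  specnorm (\sum_(i <- r) F i) <= \sum_(i <- r) specnorm (F i).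
Proof.
elim/big_ind2 : _ => [|x1 x2 y1 y2 h1 h2|//]; first by rewrite specnorm0.
exact: le_trans (specnormD _ _) (lerD h1 h2).
Qed.

End Euclid.

(** * Derivatives along lines, mean value bounds and the tangent inequality *)

Section Calculus.
Variables (R : realType) (d : nat).
Implicit Types (g : 'rV[R]_d -> R) (x y u v w p : 'rV[R]_d).

Lemma is_derive_line g x v (s : R) : differentiable g (x + s *: v) ->
  is_derive s 1 (fun t => g (x + t *: v)) ('D_v g (x + s *: v)).
Proof.
move=> dgx; have dg := @diff_derivable _ _ _ _ _ v dgx.
have e : (fun h : R => h^-1 *: (((fun t => g (x + t *: v)) \o shift s) (h *: 1)
                            - g (x + s *: v))) =
         (fun h : R => h^-1 *: ((g \o shift (x + s *: v)) (h *: v) - g (x + s *: v))).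
  apply/funext => h /=; rewrite [h *: 1]mulr1 scalerDl.
  by rewrite addrCA.
by apply: DeriveDef; rewrite /derivable /derive e.
Qed.

Lemma derive_grad g x v : differentiable g x -> 'D_v g x = dot (grad g x) v.
Proof.
move=> dg; rewrite deriveE// [v in LHS]row_sum_delta linear_sum.
by apply: eq_bigr => i _; rewrite linearZ /= mxE deriveE// mulrC.
Qed.

Lemma dot_cvg T (F : set_system T) {FF : Filter F} (G : T -> 'rV[R]_d)
    (l w : 'rV[R]_d) :
  G @ F --> l -> (fun t => dot w (G t)) @ F --> dot w l.
Proof.
move=> Gl; rewrite /dot.
have -> : (fun t => \sum_(i < d) w 0 i * G t 0 i) =
   \sum_(i < d) (fun t => w 0 i * G t 0 i) by apply/funext => t; rewrite fct_sumE.
elim/big_ind2 : _ => [|f1 l1 f2 l2 h1 h2|i _]; first exact: cvg_cst.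
  exact: cvgD.
apply: cvgM; first exact: cvg_cst.
exact: (continuous_cvg _ (@coord_continuous _ _ _ 0 i l) Gl).
Qed.

(** Pairing the gradient with a fixed [w] gives a real function on the line, to which the
    one-dimensional mean value theorem applies. *)
Lemma is_derive_grad_line g x v w (s : R) :
  differentiable (grad g) (x + s *: v) ->
  is_derive s 1 (fun t => dot w (grad g (x + t *: v)))
                (dot w (v *m hess g (x + s *: v))).
Proof.
move=> dg; have dv := @diff_derivable _ _ _ _ _ v dg.
set p := x + s *: v in dg dv *.
have dl : (fun h : R => h^-1 *: ((grad g \o shift p) (h *: v) - grad g p)) @ 0^' -->
    v *m hess g p by rewrite /hess -deriveEjacobian.
have e : (fun h : R => h^-1 *: (((fun t => dot w (grad g (x + t *: v))) \o shift s) (h *: 1)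
                            - dot w (grad g p))) =
   (fun h : R => dot w (h^-1 *: ((grad g \o shift p) (h *: v) - grad g p))).
  apply/funext => h /=; rewrite [h *: 1]mulr1 scalerDl dotZr dotDr dotNr.
  by rewrite addrCA.
have c := @dot_cvg R _ (dnbhs_filter 0) _ _ w dl.
rewrite -e in c; apply: DeriveDef; first exact: cvgP c.
exact: cvg_lim c.
Qed.

(** Stands in for integrating the bound on [df]: the mean value theorem is applied to [f] minus the
    primitive of the affine bound. *)
Lemma mean_value_le (f df : R -> R) (a b : R) :
  (forall s : R, is_derive s 1 f (df s)) ->
  (forall s, 0 <= s <= 1 -> df s <= a + b * s) ->
  f 1 - f 0 <= a + b / 2.
Proof.
move=> dfE dfle.
pose q (s : R) := f s - (a * s + b / 2 * s ^+ 2).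
have dq (s : R) : is_derive s 1 q (df s - (a + b * s)).
  have /is_derive_eq := is_deriveB (dfE s)
    (is_deriveD (is_deriveZ a (is_derive_id s 1))
                (is_deriveZ (b / 2) (is_deriveX 2 (is_derive_id s 1)))).
  by apply; rewrite /GRing.scale /=; field.
have [|c c01] := @MVT _ q _ 0 1 ltr01 (fun s _ => dq s).
  apply: continuous_subspaceT => s; apply/differentiable_continuous.
  by apply/derivable1_diffP; exact: ex_derive.
rewrite /q subr0 mulr1 => e.
have := dfle c; move: c01; rewrite in_itv /= => /andP[c0 c1].
by rewrite (ltW c0) (ltW c1) => /(_ isT); lra.
Qed.

(** If [g y] were below the tangent, the difference quotients at small [t] would exceed [g y - g x],
    which convexity on the segment forbids. *)
Lemma convex_above_tangent g x y :
  convex_function [set: convex_lmodType 'rV[R]_d] g -> differentiable g x ->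
  g x + dot (grad g x) (y - x) <= g y.
Proof.
move=> cg dg; rewrite -derive_grad//; set v := y - x.
rewrite -lerBrDl leNgt; apply/negP => lt_D.
have /cvgr_gt/(_ _ lt_D) := @diff_derivable _ _ _ _ _ v dg.
rewrite near_withinE /= => /nbhs_ballP[e /= e0 near_e].
pose t := Num.min (e / 2) 1.
have t0 : 0 < t by rewrite lt_min ltr01 divr_gt0.
have t1 : t <= 1 by rewrite ge_min lexx orbT.
have te : t < e by rewrite (le_lt_trans (y := e / 2)) ?ge_min ?lexx//; lra.
have := near_e t; rewrite /ball /= sub0r normrN gtr0_norm// => /(_ te).
rewrite gt_eqF// => /(_ isT).
have := cg (Itv01 (ltW t0) t1) y x; rewrite !inE => /(_ I I).
rewrite convRE /=.
have -> : conv (Itv01 (ltW t0) t1) (y : convex_lmodType 'rV[R]_d) x = t *: v + x.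
  by rewrite /conv /= /unstable.onem scalerBr scalerBl scale1r -[RHS]addrA (addrC x).
move=> cle; rewrite /GRing.scale /= ltNge => /negP; apply.
rewrite ler_pdivrMl//; move: cle; rewrite /unstable.onem; lra.
Qed.

(** The limit [t -> 0+] in perturbation arguments: Hessian symmetry, stationarity of the cubic step,
    quadratic growth. *)
Lemma le_of_le_addMr (a b c : R) :
  (forall t, 0 < t -> t <= 1 -> a <= b + t * c) -> a <= b.
Proof.
move=> h; rewrite leNgt; apply/negP => ltba.
have c0 : 0 < c by have := h 1 ltr01 (lexx _); lra.
pose t := Num.min ((a - b) / (2 * c)) 1.
have t0 : 0 < t by rewrite lt_min ltr01 divr_gt0 ?subr_gt0// mulr_gt0.
have t1 : t <= 1 by rewrite ge_min lexx orbT.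
have : t * c <= (a - b) / (2 * c) * c by rewrite ler_pM2r// ge_min lexx.
have -> : (a - b) / (2 * c) * c = (a - b) / 2 by field; rewrite gt_eqF.
by have := h _ t0 t1; lra.
Qed.

(** * Taylor bounds and symmetry of the Hessian from derivatives along lines *)

Section LipschitzHessian.
Variables (g : 'rV[R]_d -> R) (G : 'rV[R]_d -> 'rV[R]_d) (H : 'rV[R]_d -> 'M[R]_d).
Variable L : R.
Hypothesis L_ge0 : 0 <= L.
Hypothesis g_line : forall x v (s : R),
  is_derive s 1 (fun t => g (x + t *: v)) (dot (G (x + s *: v)) v).
Hypothesis G_line : forall x v w (s : R),
  is_derive s 1 (fun t => dot w (G (x + t *: v))) (dot w (v *m H (x + s *: v))).
Hypothesis H_lip : forall x y, specnorm (H x - H y) <= L * enorm (x - y).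

Lemma dot_hess_line x p u w :
  dot w (u *m H (x + p)) <= dot w (u *m H x) + L * enorm p * enorm u * enorm w.
Proof.
rewrite -lerBlDl -dotNr -dotDr -mulmxBr.
apply: le_trans (cauchy_schwarz _ _) _; rewrite mulrC ler_wpM2r ?enorm_ge0//.
apply: le_trans (enorm_mulmx _ _) _; rewrite ler_wpM2r ?enorm_ge0//.
by apply: le_trans (H_lip _ _) _; rewrite addrAC subrr add0r.
Qed.

Lemma dot_grad_taylor x v w :
  dot w (G (x + v)) - dot w (G x)
  <= dot w (v *m H x) + L / 2 * enorm v ^+ 2 * enorm w.
Proof.
have /(_ _)/wrap[s /andP[s0 s1]|] := @mean_value_le _ _ (dot w (v *m H x))
  (L * enorm v ^+ 2 * enorm w) (G_line x v w).
  apply: le_trans (dot_hess_line _ _ _ _) _.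
  by rewrite enormZ (ger0_norm s0); lra.
by rewrite scale1r scale0r addr0; lra.
Qed.

(** The scalar estimate [dot_grad_taylor] is tested on the error vector itself and divided by its
    norm. *)
Lemma grad_taylor x v :
  enorm (G (x + v) - G x - v *m H x) <= L / 2 * enorm v ^+ 2.
Proof.
set e := _ - _ - _.
have := dot_grad_taylor x v e.
have : dot e e = dot e (G (x + v)) - dot e (G x) - dot e (v *m H x).
  by rewrite {2}/e !dotDr !dotNr.
rewrite -enorm_sqr => ee le.
have {}le : enorm e * enorm e <= L / 2 * enorm v ^+ 2 * enorm e by lra.
have := enorm_ge0 e; rewrite le_eqVlt => /orP[/eqP <-|e0].
  by rewrite mulr_ge0 ?divr_ge0// sqr_ge0.
by rewrite ler_pM2r in le.
Qed.

(** The second difference is the increment over [0, 1] of [g (x + p + s *: q) - g (x + s *: q)],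
    whose derivative is a gradient increment. The signs [c = 1] and [c = -1] give the upper and the
    lower bound. *)
Lemma second_difference_le (c : R) x p q : `|c| = 1 ->
  c * (g (x + p + q) - g (x + p) - g (x + q) + g x)
  <= c * dot q (p *m H x)
     + (L / 2 * enorm p ^+ 2 * enorm q + L / 2 * enorm p * enorm q ^+ 2).
Proof.
move=> c1.
have df (s : R) := is_deriveZ c (is_deriveB (g_line (x + p) q s) (g_line x q s)).
have := @mean_value_le _ _ (c * dot q (p *m H x) + L / 2 * enorm p ^+ 2 * enorm q)
  (L * enorm p * enorm q ^+ 2) df.
move=> /(_ _)/wrap[s /andP[s0 s1]|].
  have := dot_grad_taylor (x + s *: q) p (c *: q).
  have := dot_hess_line x (s *: q) p (c *: q).
  rewrite (addrAC x) !enormZ c1 (ger0_norm s0) !dotZl !(dotC q (G _)).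
  rewrite -[c *: _]/(c * _).
  by lra.
rewrite -[(_ \*: _) 1]/(c * (g (x + p + 1 *: q) - g (x + 1 *: q))).
rewrite -[(_ \*: _) 0]/(c * (g (x + p + 0 *: q) - g (x + 0 *: q))).
by rewrite !scale1r !scale0r !addr0; lra.
Qed.

(** The second difference is symmetric in [p] and [q]. At scale [t] it equals the bilinear form
    times [t ^+ 2] up to an error of order [t ^+ 3], so dividing by [t ^+ 2] and letting [t] tend to
    0 exchanges the arguments. *)
Lemma hess_sym x u v : dot v (u *m H x) = dot u (v *m H x).
Proof.
have swap p q : dot q (p *m H x) <= dot p (q *m H x).
  pose K u v := L / 2 * enorm u ^+ 2 * enorm v + L / 2 * enorm u * enorm v ^+ 2.
  apply: (@le_of_le_addMr _ _ (K p q + K q p)) => t t0 _.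
  have := @second_difference_le (-1) x (t *: p) (t *: q) (normrN1 _).
  have := @second_difference_le 1 x (t *: q) (t *: p) (normr1 _).
  rewrite (addrAC x (t *: q)) /K !enormZ (gtr0_norm t0) -!scalemxAl.
  rewrite !(dotZl t) !(dotZr t) => h1 h2.
  rewrite -(ler_pM2l (exprn_gt0 2 t0)).
  by lra.
by apply/eqP; rewrite eq_le !swap.
Qed.

End LipschitzHessian.

End Calculus.

(** * Regularity passes to averages of losses *)

Section Averages.
Variables (R : realType) (d n : nat).
Implicit Types (x y v : 'rV[R]_d).

(** A general codomain [W] serves both the losses and their vector-valued gradients. *)
Lemma derive_mean (W : normedModType R) (g : 'I_n -> 'rV[R]_d -> W) x v (a : R) :
  (forall j, differentiable (g j) x) ->
  'D_v (fun y => a *: \sum_(j < n) g j y) x = a *: \sum_(j < n) 'D_v (g j) x.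
Proof.
move=> dg.
have -> : (fun y => a *: \sum_(j < n) g j y) = a \*: (\sum_(j < n) g j).
  by apply/funext => y; rewrite /= fct_sumE.
rewrite deriveZ ?derive_sum//.
- by move=> j; exact: diff_derivable.
- by apply: derivable_sum => j; exact: diff_derivable.
Qed.

Lemma differentiable_mean (W : normedModType R) (g : 'I_n -> 'rV[R]_d -> W) x (a : R) :
  (forall j, differentiable (g j) x) ->
  differentiable (fun y => a *: \sum_(j < n) g j y) x.
Proof.
move=> dg.
have -> : (fun y => a *: \sum_(j < n) g j y) = a \*: (\sum_(j < n) g j).
  by apply/funext => y; rewrite /= fct_sumE.
by apply: differentiableZ; exact: differentiable_sum.
Qed.

Lemma grad_mean (g : 'I_n -> 'rV[R]_d -> R) x (a : R) :
  (forall j, differentiable (g j) x) ->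
  grad (fun y => a * \sum_(j < n) g j y) x = a *: \sum_(j < n) grad (g j) x.
Proof.
move=> dg; apply/rowP => i; rewrite !mxE summxE.
rewrite [LHS](@derive_mean R^o g x _ a dg); congr (_ * _).
by apply: eq_bigr => j _; rewrite mxE.
Qed.

Lemma hess_mean (g : 'I_n -> 'rV[R]_d -> R) x (a : R) :
  (forall j y, differentiable (g j) y) -> (forall j y, differentiable (grad (g j)) y) ->
  hess (fun y => a * \sum_(j < n) g j y) x = a *: \sum_(j < n) hess (g j) x.
Proof.
move=> dg dg2; apply/row_matrixP => i; rewrite !rowE /hess.
have -> : grad (fun y => a * \sum_(j < n) g j y) = fun y => a *: \sum_(j < n) grad (g j) y.
  by apply/funext => y; rewrite grad_mean.
rewrite -deriveEjacobian; last exact: differentiable_mean.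
rewrite derive_mean// -scalemxAr mulmx_sumr; congr (_ *: _).
by apply: eq_bigr => j _; rewrite deriveEjacobian.
Qed.

(** Applied twice: over the samples of one agent, then over the agents. *)
Lemma regular_loss_mean (L0 L : R) (g : 'I_n -> 'rV[R]_d -> R) : (0 < n)%N ->
  (forall j, regular_loss L0 L (g j)) ->
  regular_loss L0 L (fun x => n%:R^-1 * \sum_(j < n) g j x).
Proof.
move=> n0 rg.
have n0R : 0 < n%:R :> R by rewrite ltr0n.
have mean_le (c : R) (u : 'I_n -> R) : (forall j, u j <= c) -> n%:R^-1 * \sum_(j < n) u j <= c.
  move=> uc; rewrite ler_pdivrMl//; apply: le_trans (ler_sum _ (fun j _ => uc j)) _.
  by rewrite sumr_const card_ord mulr_natl.
have dg j y : differentiable (g j) y by exact: loss_diff (rg j) y.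
have dg2 j y : differentiable (grad (g j)) y by exact: loss_diff2 (rg j) y.
split.
- move=> t x y _ _; rewrite convRE.
  rewrite mulrCA (mulrCA _ n%:R^-1) -mulrDr ler_pM2l ?invr_gt0//.
  rewrite !mulr_sumr -big_split /=; apply: ler_sum => j _.
  by have := loss_convex (rg j) t (in_setT x) (in_setT y); rewrite convRE.
- by move=> x; apply: (@differentiable_mean R^o).
- have -> : grad (fun y => n%:R^-1 * \sum_(j < n) g j y) =
      fun y => n%:R^-1 *: \sum_(j < n) grad (g j) y.
    by apply/funext => y; rewrite grad_mean.
  by move=> x; apply: differentiable_mean.
- move=> x y; rewrite -mulrBr -sumrB normrM gtr0_norm ?invr_gt0//.
  apply: le_trans (_ : n%:R^-1 * \sum_(j < n) `|g j x - g j y| <= _).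
    by rewrite ler_pM2l ?invr_gt0//; exact: ler_norm_sum.
  by apply: mean_le => j; exact: loss_lip (rg j) x y.
- move=> x y; rewrite !hess_mean// -scalerBr -sumrB.
  apply: le_trans (specnormZ _ _) _; rewrite gtr0_norm ?invr_gt0//.
  apply: le_trans (_ : n%:R^-1 * \sum_(j < n) specnorm (hess (g j) x - hess (g j) y) <= _).
    by rewrite ler_pM2l ?invr_gt0//; exact: specnorm_sum.
  by apply: mean_le => j; exact: loss_hess_lip (rg j) x y.
Qed.

End Averages.

(** * The cubic Newton step satisfies the Monteiro-Svaiter condition *)

Section CubicStep.
Variables (R : realType) (d : nat).
Implicit Types (x y z u v : 'rV[R]_d) (M : 'M[R]_d).

(** First-order expansion of the cubed norm with an explicit remainder of order [s ^+ 2], uniform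
    down to [p = 0]. *)
Lemma enorm_cube_perturb (p e : 'rV[R]_d) (s : R) : 0 <= s -> s <= 1 ->
  enorm (p - s *: e) ^+ 3 <= enorm p ^+ 3 - 3 * s * enorm p * dot p e
    + s ^+ 2 * (enorm e ^+ 2 * (3 * enorm p + enorm e)).
Proof.
move=> s0 s1; set rho := enorm (p - s *: e).
have rho2 : rho ^+ 2 = enorm p ^+ 2 - 2 * s * dot p e + s ^+ 2 * enorm e ^+ 2.
  by rewrite !enorm_sqr !dotE (dotC e p); lra.
have : `|rho - enorm p| <= s * enorm e.
  apply: le_trans (ler_enorm_dist _ _) _.
  by rewrite addrAC subrr add0r enormN enormZ ger0_norm.
rewrite ler_norml => /andP[d1 d2].
have r0 := enorm_ge0 p; have e0 := enorm_ge0 e.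
have rho0 : 0 <= rho := enorm_ge0 _.
have se0 : 0 <= s * enorm e by rewrite mulr_ge0.
have se1 : s * enorm e <= enorm e by rewrite ler_piMl.
have dist2 : (rho - enorm p) ^+ 2 <= s ^+ 2 * enorm e ^+ 2.
  by rewrite -exprMn -ler_sqrt ?sqr_ge0// !sqrtr_sqr (ger0_norm se0) ler_norml d1 d2.
have : (rho - enorm p) ^+ 2 * (rho + enorm p / 2)
    <= s ^+ 2 * enorm e ^+ 2 * (3 / 2 * enorm p + enorm e).
  by rewrite ler_pM ?sqr_ge0//; lra.
(* [rho ^+ 2] is known exactly, so the cube is written as a multiple of it plus a term quadratic in
   [rho - enorm p], which is at most [s * enorm e] in absolute value. *)
have -> : rho ^+ 3 = (rho - enorm p) ^+ 2 * (rho + enorm p / 2)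
    + 3 / 2 * enorm p * rho ^+ 2 - enorm p ^+ 3 / 2 by field.
by rewrite rho2; lra.
Qed.

(** With [e] the candidate gradient, moving from [p] to [p - s *: e] changes the model by
    [- s * dot e e] plus a term of order [s ^+ 2]; minimality then forces [dot e e <= 0]. *)
Lemma cubic_min_stationary g0 M (L : R) p :
  0 <= L -> (forall u v, dot v (u *m M) = dot u (v *m M)) ->
  (forall q, dot g0 p + 2^-1 * dot (p *m M) p + L / 3 * enorm p ^+ 3
          <= dot g0 q + 2^-1 * dot (q *m M) q + L / 3 * enorm q ^+ 3) ->
  g0 + p *m M + (L * enorm p) *: p = 0.
Proof.
move=> L0 symM pmin.
set e := _ + _; apply/eqP; rewrite -dot_eq0 eq_le dot_ge0 andbT.
have eE w : dot e w = dot g0 w + dot (p *m M) w + L * enorm p * dot p w.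
  by rewrite /e !dotDl dotZl.
have {eE} ee := eE e; move: e ee => e ee.
pose K := dot (e *m M) e / 2 + L / 3 * (enorm e ^+ 2 * (3 * enorm p + enorm e)).
apply: (@le_of_le_addMr _ _ _ K) => s s0 s1.
have := pmin (p - s *: e).
have {pmin} := ler_wpM2l (divr_ge0 L0 (ler0n R 3)) (enorm_cube_perturb p e (ltW s0) s1).
rewrite mulmxBl -scalemxAl.
move: ee; rewrite /K; have := symM p e; move: (p *m M) (e *m M) => pM eM.
rewrite !dotE (dotC pM p) (dotC eM p) => sym ee cub.
rewrite -sym (dotC e pM) => h.
by have := congr1 ( *%R s) ee; rewrite add0r -(ler_pM2l s0); lra.
Qed.

Lemma cubic_step_stationary (F : 'rV[R]_d -> R) H (beta L : R) z y :
  0 <= L -> (forall u v, dot v (u *m H z) = dot u (v *m H z)) ->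
  (forall u, cubic_model F H beta L z y <= cubic_model F H beta L z u) ->
  grad F z + (y - z) *m H z + (2 * beta + L * enorm (y - z)) *: (y - z) = 0.
Proof.
move=> L0 symH ymin.
rewrite scalerDl -mul_mx_scalar addrA -(addrA (grad F z)) -mulmxDr.
apply: cubic_min_stationary => // [u v|q].
  by rewrite !mulmxDr !dotDr !mul_mx_scalar !dotZr symH (dotC u v).
have := ymin (z + q); rewrite /cubic_model [z + q]addrC addrK.
by rewrite -!addrA lerD2l !addrA.
Qed.

(** By stationarity the residual is exactly the Taylor error of the gradient, and the assumed bound
    on that error is [lam / 2 * enorm (y - z)]. *)
Lemma cubic_step_monteiro_svaiter (F : 'rV[R]_d -> R) H (beta L lam : R) z y :
  0 <= L -> (forall u v, dot v (u *m H z) = dot u (v *m H z)) ->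
  enorm (grad F y - grad F z - (y - z) *m H z)
    <= beta * enorm (y - z) + L / 2 * enorm (y - z) ^+ 2 ->
  (forall u, cubic_model F H beta L z y <= cubic_model F H beta L z u) ->
  lam = 2 * beta + L * enorm (y - z) ->
  enorm (grad F y + lam *: (y - z)) <= lam / 2 * enorm (y - z).
Proof.
move=> L0 symH taylor ymin lamE.
have := cubic_step_stationary L0 symH ymin; rewrite -lamE => st.
have -> : grad F y + lam *: (y - z) = grad F y - grad F z - (y - z) *m H z.
  apply/eqP; rewrite -subr_eq0; apply/eqP; rewrite -st.
  move: (grad F y) (grad F z) (_ *m H z) (lam *: _) => a b c e.
  by rewrite !opprD !opprK -[- a + b + c]addrA addrACA subrr add0r addrC.
by apply: le_trans taylor _; rewrite lamE; lra.
Qed.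

End CubicStep.

(** * The regularised objective: gradient, strong convexity, inexact Hessian *)

Lemma is_derive_half_sqdist (R : realType) (d : nat) (mu : R) (a x v : 'rV[R]_d) :
  is_derive x v (fun y => mu / 2 * enorm (y - a) ^+ 2) (mu * dot (x - a) v).
Proof.
have c : (fun h : R => h^-1 *: (((fun y => mu / 2 * enorm (y - a) ^+ 2) \o shift x) (h *: v)
            - mu / 2 * enorm (x - a) ^+ 2)) @ 0^' --> mu * dot (x - a) v.
  (* For [h != 0] the difference quotient of the quadratic is exactly this affine function. *)
  have affine : (fun h : R => mu * dot (x - a) v + h * (mu / 2 * dot v v)) @ 0^'
      --> mu * dot (x - a) v.
    rewrite -[X in _ --> X]addr0 -[X in _ --> _ + X](mul0r (mu / 2 * dot v v)).
    apply: cvgD; first exact: cvg_cst.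
    apply: cvgM; last exact: cvg_cst.
    exact: nbhs_dnbhs.
  apply: cvg_trans affine; apply: near_eq_cvg.
  near=> h.
  have h0 : h != 0 by near: h; exact: nbhs_dnbhs_neq.
  rewrite /= -addrA !enorm_sqr !(dotDl (h *: v)) !(dotDr _ (h *: v)) !dotZl !dotZr.
  rewrite (dotC v (x - a)) /GRing.scale /=.
  by field.
by apply: DeriveDef; [exact: cvgP c | exact: cvg_lim c].
Unshelve. all: by end_near. Qed.

Section RegularLoss.
Variables (R : realType) (d : nat) (L0 L : R).
Implicit Types x u v : 'rV[R]_d.

Lemma is_derive_line_grad (g : 'rV[R]_d -> R) x v (s : R) :
  regular_loss L0 L g ->
  is_derive s 1 (fun t => g (x + t *: v)) (dot (grad g (x + s *: v)) v).
Proof.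
move=> rg; rewrite -derive_grad; last exact: loss_diff rg _.
exact/is_derive_line/(loss_diff rg).
Qed.

Lemma regular_hess_sym (g : 'rV[R]_d -> R) x u v : regular_loss L0 L g ->
  dot v (u *m hess g x) = dot u (v *m hess g x).
Proof.
move=> rg; apply: (@hess_sym R d g (grad g) (hess g) L).
- by move=> *; exact: is_derive_line_grad.
- by move=> *; exact/is_derive_grad_line/(loss_diff2 rg).
- exact: loss_hess_lip rg.
Qed.

End RegularLoss.

Section Objective.
Variables (R : realType) (d m n : nat) (Xi : Type).
Variables (f : 'rV[R]_d -> Xi -> R) (xi : 'I_m -> 'I_n -> Xi).
Variables (L0 L mu beta : R) (xbar : 'rV[R]_d).
Hypotheses (m_gt0 : (0 < m)%N) (n_gt0 : (0 < n)%N).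
Hypothesis f_reg : forall w, regular_loss L0 L (f^~ w).
Local Notation F := (objective f xi mu xbar).

Let mean_loss x : R := m%:R^-1 * \sum_(k < m) local_loss f xi k x.

Lemma local_loss_regular k : regular_loss L0 L (local_loss f xi k).
Proof. by apply: regular_loss_mean => // j; exact: f_reg. Qed.

Lemma mean_loss_regular : regular_loss L0 L mean_loss.
Proof. by apply: regular_loss_mean => // k; exact: local_loss_regular. Qed.

Lemma grad_objective x : grad F x = grad mean_loss x + mu *: (x - xbar).
Proof.
apply/rowP => i; rewrite mxE.
have dq := is_derive_half_sqdist mu xbar x (delta_mx 0 i).
have -> : F = mean_loss + (fun y => mu / 2 * enorm (y - xbar) ^+ 2) by [].
rewrite deriveD; last exact: ex_derive.
  rewrite derive_val !mxE; congr (_ + mu * _).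
  rewrite /dot (bigD1 i)//= !mxE !eqxx mulr1 big1 ?addr0// => j ji.
  by rewrite !mxE (negbTE ji) andbF mulr0.
exact/diff_derivable/(loss_diff mean_loss_regular).
Qed.

Lemma objective_strongly_convex x y :
  F x + dot (grad F x) (y - x) + mu / 2 * enorm (y - x) ^+ 2 <= F y.
Proof.
have := convex_above_tangent y (loss_convex mean_loss_regular)
  (loss_diff mean_loss_regular x).
rewrite grad_objective dotDl dotZl.
have -> : F x = mean_loss x + mu / 2 * enorm (x - xbar) ^+ 2 by [].
have -> : F y = mean_loss y + mu / 2 * enorm (y - xbar) ^+ 2 by [].
have -> : y - xbar = (x - xbar) + (y - x) by rewrite [RHS]addrC addrA subrK.
move: (grad mean_loss x) (x - xbar) (y - x) => D p q.
by rewrite !enorm_sqr !dotE (dotC q p); lra.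
Qed.

Lemma server_hess_sym k x u v :
  dot v (u *m server_hess f xi mu k x) = dot u (v *m server_hess f xi mu k x).
Proof.
rewrite /server_hess !mulmxDr !dotDr !mul_mx_scalar !dotZr (dotC v u).
by rewrite (regular_hess_sym _ _ _ (local_loss_regular k)).
Qed.

(** The regulariser cancels exactly. What remains splits into the Taylor error of the mean loss and
    the mismatch between the mean and the local Hessian, bounded by similarity. *)
Lemma objective_inexact_taylor k x y : 0 <= L -> similarity_bound f xi beta ->
  enorm (grad F y - grad F x - (y - x) *m server_hess f xi mu k x)
    <= beta * enorm (y - x) + L / 2 * enorm (y - x) ^+ 2.
Proof.
move=> L_ge0 sim; have rm := mean_loss_regular.
have taylor : enorm (grad mean_loss y - grad mean_loss x - (y - x) *m hess mean_loss x)
    <= L / 2 * enorm (y - x) ^+ 2.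
  have -> : grad mean_loss y = grad mean_loss (x + (y - x)) by rewrite addrC subrK.
  apply: (grad_taylor L_ge0 (G := grad mean_loss) (H := hess mean_loss)).
  - by move=> *; exact/is_derive_grad_line/(loss_diff2 rm).
  - exact: loss_hess_lip rm.
have hessE : hess mean_loss x = m%:R^-1 *: \sum_(j < m) hess (local_loss f xi j) x.
  apply: hess_mean => j z; first exact: loss_diff (local_loss_regular j) z.
  exact: loss_diff2 (local_loss_regular j) z.
have := sim k x; rewrite -hessE => simk.
have : enorm ((y - x) *m (hess mean_loss x - hess (local_loss f xi k) x)) <= beta * enorm (y - x).
  by apply: le_trans (enorm_mulmx _ _) _; rewrite ler_wpM2r ?enorm_ge0.
move: taylor; rewrite !grad_objective /server_hess mulmxBr mulmxDr mul_mx_scalar.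
have -> : mu *: (y - xbar) = mu *: (y - x) + mu *: (x - xbar).
  by rewrite -scalerDr addrA subrK.
move=> h1 h2.
have split_error (gy gx Hm Hk a b : 'rV[R]_d) :
    gy + (a + b) - (gx + b) - (Hk + a) = (gy - gx - Hm) + (Hm - Hk).
  by apply/rowP => i; rewrite !mxE; ring.
rewrite (split_error _ _ ((y - x) *m hess mean_loss x)).
by apply: le_trans (ler_enormD _ _) _; rewrite addrC lerD.
Qed.

End Objective.

(** * Growth of the weights [A] measured by a potential *)

Section Growth.
Variable R : realType.
Implicit Types (A a b h u lam K Lam theta : R).

(** The positive root [a] of [lam * a ^+ 2 = A + a]. *)
Definition estimate_step lam A := (1 + Num.sqrt (1 + 4 * lam * A)) / (2 * lam).

Lemma estimate_stepE lam A : 0 < lam -> 0 <= A ->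
  lam * estimate_step lam A ^+ 2 = A + estimate_step lam A.
Proof.
move=> l0 A0; rewrite /estimate_step; set s := Num.sqrt _.
have s2 : s ^+ 2 = 1 + 4 * lam * A.
  by rewrite sqr_sqrtr// addr_ge0// !mulr_ge0// ltW.
have -> : A = (s ^+ 2 - 1) / (4 * lam) by rewrite s2; field; rewrite gt_eqF.
by field; rewrite gt_eqF.
Qed.

Lemma estimate_step_gt0 lam A : 0 < lam -> 0 <= A -> 0 < estimate_step lam A.
Proof.
by move=> l0 A0; rewrite divr_gt0 ?mulr_gt0// ltr_wpDr// sqrtr_ge0.
Qed.

Lemma estimate_step_sqr_ge lam A : 0 < lam -> 0 <= A ->
  A / lam <= estimate_step lam A ^+ 2.
Proof.
move=> l0 A0; rewrite ler_pdivrMr// mulrC estimate_stepE// lerDl.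
exact/ltW/estimate_step_gt0.
Qed.

(** With [A = u ^+ 14] the exponents 1/2 and 2/7 of [A] become the integers 7 and 4, which keeps the
    estimates polynomial. *)
Definition growth_potential b h u := b * u ^+ 7 + h ^+ 2 * u ^+ 4.

(** Ensures a positive guess: if [b = 0], a positive potential forces [h > 0]. *)
Lemma growth_rate_gt0 b h u : 0 <= b -> 0 <= h -> 0 < u ->
  0 < growth_potential b h u -> 0 < b ^+ 2 + h ^+ 4 / u ^+ 6.
Proof.
rewrite le_eqVlt => /orP[/eqP <-|b0] h0 u0 Psi0; last first.
  by rewrite ltr_wpDr ?exprn_gt0// divr_ge0 ?exprn_ge0// ltW.
rewrite expr0n add0r divr_gt0 ?exprn_gt0// lt_def h0 andbT.
by apply: contraTneq Psi0 => ->; rewrite /growth_potential mul0r expr0n mul0r addr0 ltxx.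
Qed.

(** Put [B = b * u ^+ 7] and [H = h * u ^+ 2]. The hypotheses give [1 <= 2 * B ^+ 2 + 2 * H ^+ 7],
    so [B] or [H] is at least 1/2, while the potential is [B + H ^+ 2]. *)
Lemma initial_potential b h u lam : 0 <= b -> 0 <= h -> 0 < u ->
  0 < lam -> u ^+ 14 = lam^-1 -> lam <= 2 * b ^+ 2 + 2 * h ^+ 7 ->
  4^-1 <= growth_potential b h u.
Proof.
move=> b0 h0 u0 l0 uE lamle.
have one : 1 <= 2 * (b * u ^+ 7) ^+ 2 + 2 * (h * u ^+ 2) ^+ 7.
  have -> : 2 * (b * u ^+ 7) ^+ 2 + 2 * (h * u ^+ 2) ^+ 7
    = u ^+ 14 * (2 * b ^+ 2 + 2 * h ^+ 7) by ring.
  by rewrite uE mulrC ler_pdivlMr// mul1r.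
have bu : 0 <= b * u ^+ 7 by rewrite mulr_ge0 ?exprn_ge0// ltW.
have hu : 0 <= h * u ^+ 2 by rewrite mulr_ge0 ?exprn_ge0// ltW.
rewrite /growth_potential.
have -> : h ^+ 2 * u ^+ 4 = (h * u ^+ 2) ^+ 2 by ring.
move: (b * u ^+ 7) (h * u ^+ 2) bu hu one => B H B0 H0 one.
have H2 := sqr_ge0 H.
have [B_ge|B_lt] := leP 2^-1 B; first by lra.
suff : 2^-1 <= H by move=> H_ge; have : 2^-1 * 2^-1 <= H * H; [rewrite ler_pM|lra].
rewrite leNgt; apply/negP => H_lt.
have : B ^+ 2 <= 2^-1 ^+ 2 by rewrite lerXn2r ?nnegrE// ltW.
have : H ^+ 7 <= 2^-1 ^+ 7 by rewrite lerXn2r ?nnegrE// ltW.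
have -> : 2^-1 ^+ 7 = 128^-1 :> R by field.
by lra.
Qed.

(** Since [u ^+ 14] times the rate is at most the squared potential, the step is at least
    [u ^+ 14 / (K * Psi)]. This relative growth of [u ^+ 14] carries over to [u ^+ 4] and [u ^+ 7],
    and the factor [Psi] cancels. *)
Lemma growth_potential_increase b h u u1 lam theta Lam K :
  0 <= b -> 0 <= h -> 0 < u -> 0 <= u1 -> 1 <= Lam -> 1 <= K ->
  4^-1 <= growth_potential b h u ->
  0 < lam -> lam <= K ^+ 2 * (b ^+ 2 + h ^+ 4 / u ^+ 6) ->
  Lam^-1 <= theta ->
  u1 ^+ 14 = u ^+ 14 + theta * estimate_step lam (u ^+ 14) ->
  growth_potential b h u + (15 * Lam * K)^-1 <= growth_potential b h u1.
Proof.
move=> b0 h0 u0 u10 Lam1 K1 Psi4 l0 lamle thge u1E.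
have Lam0 : 0 < Lam by lra. have K0 : 0 < K by lra.
set Psi := growth_potential b h u in Psi4 *.
have Psi0 : 0 < Psi by lra.
have a_ge : u ^+ 14 / (K * Psi) <= estimate_step lam (u ^+ 14).
  have e0 : 0 <= estimate_step lam (u ^+ 14).
    by apply/ltW/estimate_step_gt0 => //; rewrite exprn_ge0// ltW.
  rewrite -(@ler_pXn2r _ 2)// ?nnegrE//; last first.
    by rewrite divr_ge0 ?exprn_ge0 ?mulr_ge0// ltW.
  apply: le_trans (estimate_step_sqr_ge l0 _); last by rewrite exprn_ge0// ltW.
  have U0 : 0 < u ^+ 14 by rewrite exprn_gt0.
  have -> : (u ^+ 14 / (K * Psi)) ^+ 2 = u ^+ 14 * (u ^+ 14 / (K * Psi) ^+ 2).
    by move: U0; generalize (u ^+ 14) => U _; rewrite expr_div_n mulrA.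
  rewrite ler_pM2l// ler_pdivrMr ?exprn_gt0 ?mulr_gt0// mulrC ler_pdivlMr//.
  apply: le_trans (ler_wpM2l (ltW U0) lamle) _.
  rewrite exprMn mulrCA ler_pM2l ?exprn_gt0//.
  have -> : u ^+ 14 * (b ^+ 2 + h ^+ 4 / u ^+ 6) = b ^+ 2 * u ^+ 14 + h ^+ 4 * u ^+ 8.
    by field; rewrite gt_eqF.
  rewrite /Psi /growth_potential.
  have : 0 <= 2 * b * h ^+ 2 * u ^+ 11 by rewrite !mulr_ge0 ?exprn_ge0// ltW.
  by lra.
(* The constant 15 comes from [(1 + y) ^+ 4 <= 1 + 15 * y] for [0 <= y <= 1]; here [y <= 1] because
   [Psi >= 1/4]. *)
pose y := (15 * Lam * K * Psi)^-1.
have y0 : 0 < y by rewrite invr_gt0 !mulr_gt0.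
have y1 : y <= 1.
  rewrite invf_le1 ?mulr_gt0//.
  have : 1 * 1 <= Lam * K by rewrite ler_pM.
  by move=> LK; rewrite -2!mulrA mulrA; nra.
have u14 : u ^+ 14 * (1 + 15 * y) <= u1 ^+ 14.
  rewrite u1E mulrDr mulr1 lerD2l.
  apply: le_trans (ler_pM _ _ thge a_ge); last 2 first.
  - by rewrite invr_ge0 ltW.
  - by rewrite divr_ge0 ?exprn_ge0 ?mulr_ge0// ltW.
  rewrite le_eqVlt; apply/orP; left; apply/eqP; rewrite /y; field.
  by rewrite !gt_eqF.
have uu1 : u <= u1.
  rewrite -(@ler_pXn2r _ 14) ?nnegrE// ?(ltW u0)//; apply: le_trans u14.
  by rewrite ler_peMr ?exprn_ge0 ?(ltW u0)//; lra.
(* Compare fourth powers and split [u ^+ 16 = u ^+ 2 * u ^+ 14]: the second factor gains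
   [1 + 15 * y], the first does not decrease. *)
have u4 : u ^+ 4 * (1 + y) <= u1 ^+ 4.
  rewrite leNgt; apply/negP => lt4.
  have y4 : (1 + y) ^+ 4 <= 1 + 15 * y.
    have yn n : y ^+ n.+1 <= y.
      by rewrite exprS ler_piMr ?(ltW y0)// exprn_ile1// ltW.
    by have := yn 1%N; have := yn 2%N; have := yn 3%N; lra.
  have : (u1 ^+ 4) ^+ 4 < (u ^+ 4 * (1 + y)) ^+ 4.
    have u4 : 0 <= u ^+ 4 * (1 + y) by rewrite mulr_ge0 ?exprn_ge0 ?addr_ge0// ltW.
    by rewrite ltr_pXn2r// nnegrE exprn_ge0.
  rewrite (exprMn _ (u ^+ 4)) -!exprM ltNge => /negP; apply.
  apply: le_trans (ler_wpM2l (exprn_ge0 _ (ltW u0)) y4) _.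
  have -> : u ^+ (4 * 4) = u ^+ 2 * u ^+ 14 by rewrite -exprD.
  have -> : u1 ^+ (4 * 4) = u1 ^+ 2 * u1 ^+ 14 by rewrite -exprD.
  rewrite -mulrA ler_pM ?exprn_ge0 ?(ltW u0)//; last by rewrite ler_pXn2r// nnegrE (ltW u0).
  by rewrite mulr_ge0 ?exprn_ge0 ?(ltW u0)//; lra.
have u7 : u ^+ 7 * (1 + y) <= u1 ^+ 7.
  have -> : u ^+ 7 = u ^+ 3 * u ^+ 4 by rewrite -exprD.
  have -> : u1 ^+ 7 = u1 ^+ 3 * u1 ^+ 4 by rewrite -exprD.
  rewrite -mulrA ler_pM ?exprn_ge0 ?(ltW u0)//; last by rewrite ler_pXn2r// nnegrE (ltW u0).
  by rewrite mulr_ge0 ?exprn_ge0 ?(ltW u0)//; lra.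
have -> : (15 * Lam * K)^-1 = Psi * y.
  by rewrite /y; field; rewrite !gt_eqF.
have := ler_wpM2l b0 u7; have := ler_wpM2l (exprn_ge0 2 h0) u4.
by rewrite /Psi /growth_potential; lra.
Qed.

End Growth.

(** * Energy decrease in one iteration *)

Section EnergyStep.
Variables (R : realType) (d : nat).
Implicit Types (x y z v xs g : 'rV[R]_d).

(** Square the Monteiro-Svaiter inequality and expand; 3/8 is half of [1 - 1/4]. *)
Lemma monteiro_svaiter_descent g y z (lam : R) :
  enorm (g + lam *: (y - z)) <= lam / 2 * enorm (y - z) ->
  lam * dot g (y - z) <= - (dot g g / 2) - 3 / 8 * lam ^+ 2 * enorm (y - z) ^+ 2.
Proof.
move: (y - z) => w ms.
have : enorm (g + lam *: w) ^+ 2 <= (lam / 2 * enorm w) ^+ 2.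
  by rewrite ler_pXn2r// nnegrE ?enorm_ge0// (le_trans (enorm_ge0 _) ms).
by rewrite enorm_sqr exprMn enorm_sqr !dotE (dotC w g); lra.
Qed.

Variables (F : 'rV[R]_d -> R) (G : 'rV[R]_d -> 'rV[R]_d).
Hypothesis tangent : forall x y, F x + dot (G x) (y - x) <= F y.

(** Add the tangent inequalities at the barycentre with weights [a] and [b]; the linear terms
    cancel. *)
Lemma tangent_jensen x y (a b : R) : 0 <= a -> 0 <= b -> 0 < a + b ->
  (a + b) * F ((a + b)^-1 *: (a *: x + b *: y)) <= a * F x + b * F y.
Proof.
move=> a0 b0 ab0; set p := _ *: _.
have := ler_wpM2l a0 (tangent p x); have := ler_wpM2l b0 (tangent p y).
have : (a + b) * dot (G p) p = a * dot (G p) x + b * dot (G p) y.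
  rewrite -dotZr /p scalerA mulfV ?gt_eqF// scale1r.
  by rewrite dotDr !dotZr.
by rewrite !dotDr !dotNr; lra.
Qed.

(** Combine Jensen for the new point with the tangents at [y] towards [x] (weight [theta * A]) and
    [xs] (weight [theta * a]). The definition of [z] turns the linear terms into a multiple of
    [dot (G y) (y - z)], which the descent inequality controls. *)
Lemma aine_energy_step x v y z xs (A a theta lam' lam : R) :
  0 <= A -> 0 < a -> lam' * a ^+ 2 = A + a -> 0 < theta -> theta <= 1 ->
  0 <= lam -> theta * lam <= lam' ->
  enorm (G y + lam *: (y - z)) <= lam / 2 * enorm (y - z) ->
  z = (A + a)^-1 *: (A *: x + a *: v) ->
  (A + theta * a)
    * (F ((A + theta * a)^-1 *: (((1 - theta) * A) *: x + (theta * (A + a)) *: y)) - F xs)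
  + enorm (v - (theta * a) *: G y - xs) ^+ 2 / 2
  + 3 / 8 * (theta * (A + a) * lam) * enorm (y - z) ^+ 2
  <= A * (F x - F xs) + enorm (v - xs) ^+ 2 / 2.
Proof.
move=> A0 a0 aE t0 t1 l0 tl ms zE.
have Aa0 : 0 < A + a by rewrite ltr_wpDl.
have jensen := @tangent_jensen x y ((1 - theta) * A) (theta * (A + a)).
have sumE : (1 - theta) * A + theta * (A + a) = A + theta * a by ring.
have {jensen} := jensen _ _ _; rewrite sumE => /(_ _)/wrap[].
  by rewrite mulr_ge0// subr_ge0.
move=> /(_ _)/wrap[|/(_ _)/wrap[|jensen]].
- by rewrite mulr_ge0// ltW.
- by rewrite ltr_wpDl// mulr_gt0.
have zdot : (A + a) * dot (G y) z = A * dot (G y) x + a * dot (G y) v.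
  by rewrite -dotZr zE scalerA mulfV ?gt_eqF// scale1r dotDr !dotZr.
have tx := ler_wpM2l (mulr_ge0 (ltW t0) A0) (tangent y x).
have txs := ler_wpM2l (mulr_ge0 (ltW t0) (ltW a0)) (tangent y xs).
have ms_desc := monteiro_svaiter_descent ms.
(* The gradient term is absorbed because theta * a ^+ 2 * lam <= lam' * a ^+ 2 = A + a *)
have absorb : theta * (A + a) * dot (G y) (y - z) + (theta * a) ^+ 2 / 2 * dot (G y) (G y)
    <= - (3 / 8 * (theta * (A + a) * lam) * enorm (y - z) ^+ 2).
  move: l0; rewrite le_eqVlt => /orP[/eqP l0|l0].
    (* For [lam = 0] the Monteiro-Svaiter inequality forces [G y = 0]. *)
    move: ms; rewrite -l0 scale0r addr0 !mul0r => g0.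
    have /eqP : enorm (G y) = 0 by apply/eqP; rewrite eq_le g0 enorm_ge0.
    by rewrite enorm_eq0 => /eqP ->; rewrite !dot0l !mulr0 mul0r addr0 oppr0.
  have ta : theta * a ^+ 2 * lam <= A + a.
    by rewrite -aE mulrAC ler_wpM2r// sqr_ge0.
  have gg := ler_wpM2r (dot_ge0 (G y)) ta.
  rewrite -(ler_pM2l l0).
  have m1 := ler_wpM2l (ltW (mulr_gt0 t0 Aa0)) ms_desc.
  have m2 := ler_wpM2l (ltW t0) gg.
  by lra.
have vE : enorm (v - (theta * a) *: G y - xs) ^+ 2 / 2 = enorm (v - xs) ^+ 2 / 2
    - theta * a * (dot (G y) v - dot (G y) xs) + (theta * a) ^+ 2 / 2 * dot (G y) (G y).
  by rewrite !enorm_sqr !dotE !(dotC _ (G y)) (dotC xs v); field.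
rewrite vE; move: absorb tx txs; rewrite !dotDr !dotNr => absorb tx txs.
have zt := congr1 ( *%R theta) zdot.
by lra.
Qed.

End EnergyStep.

(** * The ratio theta, far steps, and stability of the guess *)

Lemma root14 (R : realType) (A : R) : 0 <= A -> exists2 u : R, 0 <= u & u ^+ 14 = A.
Proof.
move=> A0; exists (A `^ 14^-1); first exact: powR_ge0.
by rewrite -powR_mulrn ?powR_ge0// -powRrM mulVf// powRr1.
Qed.

Section StepRatio.
Variable R : realType.

Definition step_ratio (lam' lam : R) : R := if lam == 0 then 1 else Num.min 1 (lam' / lam).

Lemma step_ratio_gt0 (lam' lam : R) : 0 < lam' -> 0 <= lam -> 0 < step_ratio lam' lam.
Proof.
move=> l'0 l0; rewrite /step_ratio; case: eqP => [//|/eqP ln0].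
by rewrite lt_min ltr01 divr_gt0// lt_def ln0.
Qed.

Lemma step_ratio_le1 (lam' lam : R) : step_ratio lam' lam <= 1.
Proof. by rewrite /step_ratio; case: eqP => // _; rewrite ge_min lexx. Qed.

Lemma step_ratio_mul_le (lam' lam : R) : 0 < lam' -> 0 <= lam -> step_ratio lam' lam * lam <= lam'.
Proof.
move=> l'0 l0; rewrite /step_ratio; case: eqP => [->|/eqP ln0]; first by rewrite mulr0 ltW.
have lp : 0 < lam by rewrite lt_def ln0.
by rewrite -ler_pdivlMr// ge_min lexx orbT.
Qed.

Lemma step_ratio_ge (lam' lam Lam : R) : 0 < lam' -> 0 <= lam -> 1 <= Lam ->
  lam <= Lam * lam' -> Lam^-1 <= step_ratio lam' lam.
Proof.
move=> l'0 l0 L1 le; have L0 : 0 < Lam by lra.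
rewrite /step_ratio; case: eqP => [_|/eqP ln0]; first by rewrite invf_le1.
have lp : 0 < lam by rewrite lt_def ln0.
rewrite le_min invf_le1// L1 /= ler_pdivlMr// mulrC ler_pdivrMr//.
by rewrite mulrC.
Qed.

Lemma step_ratio_mul (lam' lam : R) : 0 < lam' -> lam' <= lam -> step_ratio lam' lam * lam = lam'.
Proof.
move=> l'0 le; have lp := lt_le_trans l'0 le.
rewrite /step_ratio gt_eqF// min_r ?divfK ?gt_eqF//.
by rewrite ler_pdivrMr// mul1r.
Qed.

End StepRatio.

(** Let [q = h ^+ 4 / u ^+ 6]. As [lam > Lam * lam' >= 4 * (b ^+ 2 + q)] and
    [lam = 2 * b ^+ 2 + L * dist], the displacement satisfies [L * dist >= 2 * q]. The energy loss,
    scaled by [Lam * L ^+ 2], is then at least [6 * u ^+ 14 * q ^+ 3 = 6 * h ^+ 12 / u ^+ 4]. *)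
Lemma far_step_decrease (R : realType) (b h u a k1 Lam L dist lam' lam theta dE : R) :
  0 <= h -> 0 < u -> 0 <= a -> 1 <= Lam -> 4 <= Lam * k1 -> 0 <= L -> 0 <= dist ->
  0 < lam' -> k1 * (b ^+ 2 + h ^+ 4 / u ^+ 6) <= lam' ->
  lam = 2 * b ^+ 2 + L * dist -> Lam * lam' < lam -> theta * lam = lam' ->
  3 / 8 * (theta * (u ^+ 14 + a) * lam) * dist ^+ 2 <= dE ->
  L ^+ 2 * dE <= h ^+ 14 ->
  1 <= Lam * u ^+ 4 / h ^+ 12 * (L ^+ 2 * dE).
Proof.
move=> h0 u0 a0 Lam1 Lamk1 L0 d0 l'0 lam'ge lamE large ratio dEge dEle.
have Lam0 : 0 < Lam by exact: lt_le_trans Lam1.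
have b2 : 0 <= b ^+ 2 by exact: sqr_ge0.
set q := h ^+ 4 / u ^+ 6 in lam'ge.
have q0 : 0 <= q by rewrite divr_ge0 ?exprn_ge0// ltW.
have L'ge : 4 * (b ^+ 2 + q) <= Lam * lam'.
  apply: le_trans (_ : Lam * (k1 * (b ^+ 2 + q)) <= _).
    by rewrite mulrA ler_wpM2r// addr_ge0.
  by rewrite ler_pM2l.
have Ld0 : 0 <= L * dist by rewrite mulr_ge0.
have Ll' := mulr_gt0 Lam0 l'0.
have Ldpos : 0 < L * dist by lra.
have Ldsq : 4 * q ^+ 2 <= (L * dist) ^+ 2.
  have -> : 4 * q ^+ 2 = (2 * q) ^+ 2 by ring.
  have le : 2 * q <= L * dist by clearbody q; lra.
  by rewrite ler_pXn2r// nnegrE// mulr_ge0.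
have U0 : 0 < u ^+ 14 by rewrite exprn_gt0.
have decr : 3 / 8 * (u ^+ 14 * lam') * (L * dist) ^+ 2 <= L ^+ 2 * dE.
  apply: le_trans (ler_wpM2l (sqr_ge0 L) dEge).
  rewrite (mulrAC theta) ratio.
  have : 0 <= a * lam' * (L * dist) ^+ 2.
    by rewrite mulr_ge0 ?sqr_ge0// mulr_ge0// ltW.
  by lra.
(* For [h = 0] the cap [h ^+ 14] leaves no energy to lose, contradicting the strict decrease. *)
have hpos : 0 < h.
  rewrite lt_def h0 andbT; apply/eqP => hz.
  have : 0 < u ^+ 14 * lam' * (L * dist) ^+ 2.
    by rewrite mulr_gt0 ?exprn_gt0// mulr_gt0.
  by move: dEle; rewrite hz expr0n /=; lra.
have h12 : 0 < h ^+ 12 by rewrite exprn_gt0.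
have key : 6 * (h ^+ 12 / u ^+ 4) <= Lam * (L ^+ 2 * dE).
  apply: le_trans (ler_wpM2l (ltW Lam0) decr).
  have -> : 6 * (h ^+ 12 / u ^+ 4) = 3 / 8 * u ^+ 14 * (4 * q * (4 * q ^+ 2)).
    by rewrite /q; field; rewrite gt_eqF.
  have -> : Lam * (3 / 8 * (u ^+ 14 * lam') * (L * dist) ^+ 2)
    = 3 / 8 * u ^+ 14 * ((Lam * lam') * (L * dist) ^+ 2) by ring.
  apply: ler_wpM2l; first by rewrite mulr_ge0// ltW.
  apply: ler_pM => //; first by rewrite mulr_ge0.
    by rewrite mulr_ge0 ?sqr_ge0.
  by lra.
have hu : 0 < h ^+ 12 / u ^+ 4 by rewrite divr_gt0 ?exprn_gt0.
have -> : Lam * u ^+ 4 / h ^+ 12 * (L ^+ 2 * dE) = Lam * (L ^+ 2 * dE) / (h ^+ 12 / u ^+ 4).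
  by field; rewrite !gt_eqF.
by rewrite ler_pdivlMr// mul1r; lra.
Qed.

(** [A] to the power 3/2 is [u ^+ 21], and [h ^+ 14 / u ^+ 21] is the seventh power of
    [h ^+ 2 / u ^+ 3]; the exponent 2/7 leaves its square. *)
Lemma curvature_guessE (R : realType) (beta D0 L b h u : R) :
  0 <= h -> 0 < u -> b ^+ 2 = beta -> h ^+ 14 = D0 * L ^+ 2 ->
  beta + (D0 * L ^+ 2 / (u ^+ 14) `^ (3 / 2)) `^ (2 / 7) = b ^+ 2 + h ^+ 4 / u ^+ 6.
Proof.
move=> h0 u0 <- <-; congr (_ + _).
have u_ge0 := ltW u0.
have -> : (u ^+ 14) `^ (3 / 2) = u ^+ 21.
  by rewrite -!powR_mulrn// -powRrM; congr (_ `^ _); field.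
have -> : h ^+ 14 / u ^+ 21 = (h ^+ 2 / u ^+ 3) ^+ 7.
  by field; rewrite gt_eqF.
have r0 : 0 <= h ^+ 2 / u ^+ 3 by rewrite divr_ge0 ?exprn_ge0.
rewrite -powR_mulrn// -powRrM.
have -> : 7%:R * (2 / 7) = 2%:R :> R by field.
by rewrite powR_mulrn//; field; rewrite gt_eqF.
Qed.

(** The guess is refreshed when [A] has more than doubled, so a stored one is off by a factor of at
    most 2: [u ^+ 14 <= 2 * ur ^+ 14] and [ur <= u] give [u ^+ 6 <= 2 * ur ^+ 6]. *)
Lemma curvature_guess_stable (R : realType) (h u ur : R) : 0 <= h -> 0 < ur -> ur <= u ->
  u ^+ 14 <= 2 * ur ^+ 14 -> h ^+ 4 / u ^+ 6 <= h ^+ 4 / ur ^+ 6 <= 2 * (h ^+ 4 / u ^+ 6).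
Proof.
move=> h0 ur0 uru le14; have u0 := lt_le_trans ur0 uru.
have h4 : 0 <= h ^+ 4 by rewrite exprn_ge0.
have p n : ur ^+ n <= u ^+ n by rewrite lerXn2r ?nnegrE// ltW.
have le6 : u ^+ 6 <= 2 * ur ^+ 6.
  rewrite -(ler_pM2r (exprn_gt0 8 ur0)).
  have -> : 2 * ur ^+ 6 * ur ^+ 8 = 2 * ur ^+ 14 by ring.
  by apply: le_trans le14; rewrite (exprD u 6 8) ler_wpM2l ?exprn_ge0// ltW.
rewrite ler_wpM2l//=; last by rewrite lef_pV2 ?posrE ?exprn_gt0.
rewrite mulrCA ler_wpM2l// -[leRHS]invrK lef_pV2 ?posrE ?exprn_gt0//.
  by rewrite invfM invrK mulrC ler_pdivrMr// mulrC.
by rewrite invr_gt0 mulr_gt0// invr_gt0 exprn_gt0.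
Qed.

(** * Convergence rate of Algorithm A *)

Section Iteration.
Variables (R : realType) (d : nat) (F : 'rV[R]_d -> R).
Variables (orc : 'rV[R]_d -> 'rV[R]_d * R) (beta L D0 b h k1 k2 Lam K : R).
Variables (xs : 'rV[R]_d).
Hypothesis tangent : forall x y, F x + dot (grad F x) (y - x) <= F y.
Hypothesis xs_min : forall x, F xs <= F x.
Hypothesis orc_ms : forall z,
  enorm (grad F (orc z).1 + (orc z).2 *: ((orc z).1 - z))
    <= (orc z).2 / 2 * enorm ((orc z).1 - z).
Hypothesis orc_lam : forall z, (orc z).2 = 2 * beta + L * enorm ((orc z).1 - z).
Hypotheses (L_ge0 : 0 <= L) (b_ge0 : 0 <= b) (h_ge0 : 0 <= h).
Hypotheses (b_sqr : b ^+ 2 = beta) (h14 : h ^+ 14 = D0 * L ^+ 2).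
Hypotheses (Lam_ge1 : 1 <= Lam) (K_ge1 : 1 <= K) (k1_gt0 : 0 < k1).
Hypotheses (Lam_k1 : 4 <= Lam * k1) (K_k2 : 2 * k2 <= K ^+ 2).
Implicit Types (x y z v : 'rV[R]_d) (u A E lam : R).

Let energy x v A : R := A * (F x - F xs) + enorm (v - xs) ^+ 2 / 2.

Let lam_ge0 z : 0 <= (orc z).2.
Proof. by rewrite orc_lam -b_sqr addr_ge0 ?mulr_ge0 ?sqr_ge0 ?enorm_ge0. Qed.

Let energy_ge0 x v A : 0 <= A -> 0 <= energy x v A.
Proof.
by move=> A0; rewrite addr_ge0 ?divr_ge0 ?sqr_ge0// mulr_ge0 ?subr_ge0.
Qed.

(* The first summand pays for the iterations with lam <= Lam * lam', the second for
   the others, whose displacement consumes the energy. *)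
Let budget E0 u E := 15 * Lam * K * growth_potential b h u
  + Lam * u ^+ 4 / h ^+ 12 * (L ^+ 2 * (E0 - E)).

(** In each iteration one summand of the budget grows by at least 1 and the other does not decrease,
    so the budget bounds the number of iterations. *)
Lemma budget_increase E0 x v u a x1 y z v1 lam (lam' theta : R) :
  0 < u -> 4^-1 <= growth_potential b h u ->
  energy x v (u ^+ 14) <= E0 -> E0 <= D0 ->
  k1 * (b ^+ 2 + h ^+ 4 / u ^+ 6) <= lam' ->
  lam' <= K ^+ 2 * (b ^+ 2 + h ^+ 4 / u ^+ 6) ->
  a = estimate_step lam' (u ^+ 14) ->
  z = (u ^+ 14 + a)^-1 *: (u ^+ 14 *: x + a *: v) ->
  orc z = (y, lam) -> theta = step_ratio lam' lam ->
  x1 = (u ^+ 14 + theta * a)^-1 *: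
         (((1 - theta) * u ^+ 14) *: x + (theta * (u ^+ 14 + a)) *: y) ->
  v1 = v - (theta * a) *: grad F y ->
  exists u1, [/\ u <= u1, u1 ^+ 14 = u ^+ 14 + theta * a,
    energy x1 v1 (u1 ^+ 14) <= energy x v (u ^+ 14) &
    budget E0 u (energy x v (u ^+ 14)) + 1 <= budget E0 u1 (energy x1 v1 (u1 ^+ 14))].
Proof.
move=> u0 Psi4 EE0 E0D0 lam'ge lam'le aE zE orcE thE x1E v1E.
have Lam0 : 0 < Lam by exact: lt_le_trans Lam_ge1.
have K0 : 0 < K by exact: lt_le_trans K_ge1.
have A0 : 0 < u ^+ 14 by rewrite exprn_gt0.
have q0 : 0 <= h ^+ 4 / u ^+ 6 by rewrite divr_ge0 ?exprn_ge0// ltW.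
have l'0 : 0 < lam'.
  apply: lt_le_trans lam'ge; rewrite mulr_gt0//.
  by apply: (growth_rate_gt0 b_ge0 h_ge0 u0); lra.
have lam_ge0' : 0 <= lam by have := lam_ge0 z; rewrite orcE.
have a0 : 0 < a by rewrite aE estimate_step_gt0// ltW.
have th0 : 0 < theta by rewrite thE step_ratio_gt0.
have th1 : theta <= 1 by rewrite thE step_ratio_le1.
have [u1 u10 u1E] : exists2 u1, 0 <= u1 & u1 ^+ 14 = u ^+ 14 + theta * a.
  by apply: root14; rewrite addr_ge0 ?mulr_ge0// ltW.
have uu1 : u <= u1.
  rewrite -(@ler_pXn2r _ 14) ?nnegrE// ?(ltW u0)// u1E lerDl.
  by rewrite mulr_ge0// ltW.
exists u1; have step : energy x1 v1 (u1 ^+ 14)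
    + 3 / 8 * (theta * (u ^+ 14 + a) * lam) * enorm (y - z) ^+ 2 <= energy x v (u ^+ 14).
  have aE' : lam' * a ^+ 2 = u ^+ 14 + a by rewrite aE estimate_stepE// ltW.
  have th_lam : theta * lam <= lam' by rewrite thE step_ratio_mul_le.
  have ms := orc_ms z; rewrite orcE /= in ms.
  rewrite /energy u1E x1E v1E.
  exact: (aine_energy_step tangent _ (ltW A0) a0 aE' th0 th1 lam_ge0' th_lam ms zE).
move: (energy x1 v1 (u1 ^+ 14)) (energy_ge0 x1 v1 (exprn_ge0 14 u10)) step => E1 E1_ge0.
move: (energy x v (u ^+ 14)) EE0 => E EE0 step.
set dist := enorm (y - z) in step.
have dec0 : 0 <= 3 / 8 * (theta * (u ^+ 14 + a) * lam) * dist ^+ 2.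
  have Aa : 0 <= u ^+ 14 + a by rewrite addr_ge0// ltW.
  by rewrite mulr_ge0 ?sqr_ge0// mulr_ge0 ?divr_ge0// mulr_ge0// mulr_ge0// (ltW th0).
split=> //; first by lra.
have u4 : u ^+ 4 <= u1 ^+ 4 by rewrite ler_pXn2r// nnegrE ltW.
(* At [h = 0] this inverse is 0 and the second summand of the budget vanishes. In general its weight
   increases with [u], so energy already spent keeps at least its value. *)
have h12 : 0 <= (h ^+ 12)^-1 by rewrite invr_ge0 exprn_ge0.
have coef : Lam * u ^+ 4 / h ^+ 12 <= Lam * u1 ^+ 4 / h ^+ 12.
  by rewrite ler_wpM2r// ler_pM2l.
have coef0 : 0 <= Lam * u ^+ 4 / h ^+ 12.
  by rewrite !mulr_ge0 ?exprn_ge0// ltW.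
have LE : L ^+ 2 * (E0 - E) <= L ^+ 2 * (E0 - E1).
  by rewrite ler_wpM2l ?sqr_ge0//; lra.
have LE0 : 0 <= L ^+ 2 * (E0 - E) by rewrite mulr_ge0 ?sqr_ge0//; lra.
have spent := ler_pM coef0 LE0 coef LE.
(* In the small case the potential gains [(15 * Lam * K)^-1], hence the factor in the budget; in the
   large case [far_step_decrease] supplies the unit. *)
have [small|large] := leP lam (Lam * lam').
  have th_ge : Lam^-1 <= theta by rewrite thE step_ratio_ge.
  rewrite aE in u1E.
  have grow := growth_potential_increase b_ge0 h_ge0 u0 u10 Lam_ge1 K_ge1 Psi4 l'0
    lam'le th_ge u1E.
  have LK : 0 < 15 * Lam * K by rewrite !mulr_gt0.
  have := ler_wpM2l (ltW LK) grow; rewrite mulrDr mulfV ?gt_eqF//.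
  by rewrite /budget; lra.
have mono : growth_potential b h u <= growth_potential b h u1.
  by rewrite lerD// ler_wpM2l ?exprn_ge0// ler_pXn2r// nnegrE ltW.
suff : 1 <= Lam * u ^+ 4 / h ^+ 12 * (L ^+ 2 * (E - E1)).
  have := ler_wpM2r (le_trans LE0 LE) coef.
  have := ler_wpM2l (ltW (mulr_gt0 (mulr_gt0 (ltr0Sn R 14) Lam0) K0)) mono.
  by rewrite /budget; lra.
apply: (@far_step_decrease _ b h u a k1 Lam L dist lam' lam theta (E - E1)) => //.
- exact: ltW.
- exact: enorm_ge0.
- by have := orc_lam z; rewrite orcE b_sqr.
- by rewrite thE step_ratio_mul// (le_trans _ (ltW large))// ler_peMl// ltW.
- by lra.
- by rewrite h14 mulrC ler_wpM2r ?sqr_ge0//; lra.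
Qed.

Variables (kap : nat -> R) (x0 : 'rV[R]_d).
Hypothesis kap_bound : forall j, k1 <= kap j <= k2.
Hypothesis x0_close : enorm (x0 - xs) ^+ 2 / 2 <= D0.
Hypothesis lam0_neq0 : (orc x0).2 != 0.
Local Notation E0 := (enorm (x0 - xs) ^+ 2 / 2).

Let guess u : R := b ^+ 2 + h ^+ 4 / u ^+ 6.

(** The stored guess is described only for [1 < j]: after the first iteration it still has its
    initial value 0, and the second iteration sets it. *)
Definition aine_invariant (j : nat) (st : aine_state R d) : Prop :=
  exists u x v Ar lamr,
  [/\ st = AineState x v (u ^+ 14) Ar lamr,
      0 < u /\ 4^-1 <= growth_potential b h u,
      energy x v (u ^+ 14) <= E0,
      (1 < j)%N -> exists ur k, [/\ 0 < ur, ur <= u, Ar = ur ^+ 14,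
                                   lamr = k * guess ur & k1 <= k <= k2]
    & j%:R <= budget E0 u (energy x v (u ^+ 14))].

Lemma aine_invariant_step j st : (0 < j)%N -> aine_invariant j st ->
  aine_invariant j.+1 (aine_step F orc beta L D0 kap x0 j st).
Proof.
move=> j0 [u [x [v [Ar [lamr [-> [u0 Psi4] EE0 store count]]]]]].
rewrite /aine_step (gtn_eqF j0).
(* Fresh or stored, the guess has this form: with [ur = u] after a refresh, and by the failed
   doubling test otherwise. *)
have [ur [k [ur0 uru u14 kb ->]]] : exists ur k,
    [/\ 0 < ur, ur <= u, u ^+ 14 <= 2 * ur ^+ 14, k1 <= k <= k2 &
     (if (j == 1)%N || ((1 < j)%N && (2 * Ar < u ^+ 14)) then
      (u ^+ 14, kap j * (beta + (D0 * L ^+ 2 / (u ^+ 14) `^ (3 / 2)) `^ (2 / 7)))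
      else (Ar, lamr)) = (ur ^+ 14, k * guess ur)].
  case: ifPn => [_|].
    exists u, (kap j); split=> //.
      by have : 0 < u ^+ 14 by [rewrite exprn_gt0]; lra.
    by rewrite (curvature_guessE h_ge0 u0 b_sqr h14).
  rewrite negb_or => /andP[j1]; have {j1} jgt1 : (1 < j)%N by rewrite ltn_neqAle eq_sym j1.
  rewrite jgt1 /= -leNgt => le2.
  have [ur [k [ur0 uru ArE lamrE kb]]] := store jgt1.
  by exists ur, k; split=> //; rewrite ?ArE ?lamrE// -ArE.
have /andP[qle qge] := curvature_guess_stable h_ge0 ur0 uru u14.
have /andP[k1k kk2] := kb.
have k0 : 0 < k := lt_le_trans k1_gt0 k1k.
set lam' := k * guess ur.
have b2 := sqr_ge0 b.
have q0 : 0 <= h ^+ 4 / u ^+ 6 by rewrite divr_ge0 ?exprn_ge0// ltW.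
have lam'ge : k1 * (b ^+ 2 + h ^+ 4 / u ^+ 6) <= lam'.
  by rewrite ler_pM// ?(ltW k1_gt0) ?addr_ge0// lerD2l.
(* The factor 2 in [K_k2] pays for a stored guess. *)
have lam'le : lam' <= K ^+ 2 * (b ^+ 2 + h ^+ 4 / u ^+ 6).
  apply: le_trans (ler_wpM2r (addr_ge0 b2 q0) K_k2); rewrite (mulrC 2) -mulrA.
  apply: ler_pM => //; first exact: ltW.
    by rewrite addr_ge0// divr_ge0 ?exprn_ge0// ltW.
  by rewrite /guess; lra.
case orcE : (orc _) => [y lam].
have [u1 [uu1 u1E EE1 count1]] := budget_increase u0 Psi4 EE0 x0_close lam'ge lam'le
  (erefl _) (erefl _) orcE (erefl _) (erefl _) (erefl _).
have u10 := lt_le_trans u0 uu1.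
exists u1; do 4!eexists; split.
- by rewrite u1E.
- split=> //; apply: le_trans Psi4 _.
  by rewrite lerD// ler_wpM2l ?exprn_ge0// lerXn2r// nnegrE ltW.
- by apply: le_trans EE0; exact: EE1.
- move=> _; exists ur, k; split=> //; exact: le_trans uru uu1.
- by rewrite -natr1; apply: le_trans count1; rewrite lerD2r.
Qed.

(** Here [lam'] is [lam] itself, so [theta = 1] and the first weight is [lam^-1]. The energy step
    gives [dist ^+ 2 <= 8 / 3 * E0], hence [lam <= 2 * b ^+ 2 + 2 * h ^+ 7], and [initial_potential]
    applies. *)
Lemma aine_invariant_first :
  aine_invariant 1 (aine_iter F orc beta L D0 kap x0 1).
Proof.
have lam_gt0 : 0 < (orc x0).2 by rewrite lt_def lam0_neq0 lam_ge0.
rewrite /= /aine_step /=; case orcE : (orc x0) => [y lam].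
have ms := orc_ms x0; have lamE := orc_lam x0.
rewrite orcE /= in ms lamE lam_gt0.
rewrite -/(estimate_step lam 0) -/(step_ratio lam lam).
set a := estimate_step lam 0; set theta := step_ratio lam lam.
have aE : a = lam^-1.
  by rewrite /a /estimate_step mulr0 addr0 sqrtr1; field; rewrite gt_eqF.
have thE : theta = 1.
  by rewrite /theta /step_ratio gt_eqF// divff ?gt_eqF// minxx.
have a0 : 0 < a by rewrite aE invr_gt0.
have zE : x0 = (0 + a)^-1 *: (0 *: x0 + a *: x0).
  by rewrite scale0r !add0r scalerA mulVf ?gt_eqF// scale1r.
have al : a * lam = 1 by rewrite aE mulVf ?gt_eqF.
have aa : lam * a ^+ 2 = 0 + a by rewrite expr2 mulrA (mulrC lam) al mul1r add0r.
have step := @aine_energy_step _ _ _ _ tangent x0 x0 y x0 xs 0 a 1 lam lam (lexx _) a0 aa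
  ltr01 (lexx _) (ltW lam_gt0).
rewrite !mul1r !add0r mul0r add0r al in step.
have {}step := step (lexx _) ms _; rewrite add0r in zE.
have {step} := step zE; rewrite thE !mul1r add0r.
have [u u_ge0 uE] := root14 (ltW a0).
have u0 : 0 < u.
  by rewrite lt_def u_ge0 andbT; apply: contraTneq a0 => u0; rewrite -uE u0 expr0n ltxx.
move: lamE; set dist := enorm (y - x0); rewrite -b_sqr -uE => lamE step.
have dist0 : 0 <= dist by exact: enorm_ge0.
have dist_le : dist ^+ 2 <= 8 / 3 * E0.
  have := energy_ge0 ((u ^+ 14)^-1 *: (((1 - 1) * 0) *: x0 + u ^+ 14 *: y))
    (x0 - u ^+ 14 *: grad F y) (exprn_ge0 14 u_ge0).
  by rewrite /energy; lra.
have Ldist : L * dist <= 2 * h ^+ 7.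
  rewrite -(@ler_pXn2r _ 2) ?nnegrE// ?mulr_ge0 ?exprn_ge0// exprMn.
  have -> : (2 * h ^+ 7) ^+ 2 = 4 * h ^+ 14 by ring.
  have := ler_wpM2l (sqr_ge0 L) dist_le; have := ler_wpM2l (sqr_ge0 L) x0_close.
  rewrite h14 (mulrC D0); have : 0 <= L ^+ 2 * D0 by rewrite mulrC -h14 exprn_ge0.
  by lra.
have Psi4 : 4^-1 <= growth_potential b h u.
  apply: (@initial_potential _ b h u lam) => //; last by lra.
  by rewrite uE aE.
have Estep : energy ((u ^+ 14)^-1 *: (((1 - 1) * 0) *: x0 + u ^+ 14 *: y))
    (x0 - u ^+ 14 *: grad F y) (u ^+ 14) <= E0.
  by rewrite /energy; have := sqr_ge0 dist; lra.
exists u; do 4!eexists; split=> //.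
rewrite /budget.
have spent : 0 <= Lam * u ^+ 4 / h ^+ 12 * (L ^+ 2 * (E0 - energy
    ((u ^+ 14)^-1 *: (((1 - 1) * 0) *: x0 + u ^+ 14 *: y))
    (x0 - u ^+ 14 *: grad F y) (u ^+ 14))).
  rewrite mulr_ge0 ?mulr_ge0 ?invr_ge0 ?exprn_ge0 ?sqr_ge0 ?subr_ge0//.
  exact: le_trans Lam_ge1.
have LK1 : 1 * 1 <= Lam * K by rewrite ler_pM.
have : 1 * 1 * 4^-1 <= Lam * K * growth_potential b h u by rewrite ler_pM.
by lra.
Qed.

(** The total energy satisfies [L ^+ 2 * E0 <= h ^+ 14], so the second summand of the budget is at
    most [Lam * h ^+ 2 * u ^+ 4], hence at most [Lam * K] times the potential. This raises the
    constant from 15 to 16. *)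
Lemma aine_rate t : (0 < t)%N -> exists u, [/\ 0 < u,
  F (st_x (aine_iter F orc beta L D0 kap x0 t)) - F xs <= D0 / u ^+ 14 &
  t%:R <= 16 * Lam * K * growth_potential b h u].
Proof.
move=> t0; have inv : aine_invariant t (aine_iter F orc beta L D0 kap x0 t).
  case: t t0 => // t _; elim: t => [|t ih]; first exact: aine_invariant_first.
  exact: aine_invariant_step.
have [u [x [v [Ar [lamr [-> [u0 Psi4] EE0 _ count]]]]]] := inv.
exists u; split=> //=.
  rewrite ler_pdivlMr ?exprn_gt0// mulrC; apply: le_trans x0_close.
  apply: le_trans EE0; rewrite /energy lerDl.
  by rewrite divr_ge0 ?sqr_ge0.
apply: le_trans count _; rewrite /budget.
have Lam0 : 0 <= Lam by exact: le_trans Lam_ge1.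
have spent : Lam * u ^+ 4 / h ^+ 12 * (L ^+ 2 * (E0 - energy x v (u ^+ 14)))
    <= Lam * (h ^+ 2 * u ^+ 4).
  have coef0 : 0 <= Lam * u ^+ 4 / h ^+ 12.
    by rewrite !mulr_ge0 ?invr_ge0 ?exprn_ge0// ltW.
  apply: le_trans (_ : Lam * u ^+ 4 / h ^+ 12 * h ^+ 14 <= _).
    rewrite ler_wpM2l// h14 mulrC ler_wpM2r ?sqr_ge0//.
    by have := energy_ge0 x v (exprn_ge0 14 (ltW u0)); move: x0_close; lra.
  have [->|hn0] := eqVneq h 0; first by rewrite !expr0n /= !mulr0 mul0r mulr0.
  by rewrite le_eqVlt; apply/orP; left; apply/eqP; field.
have bu : 0 <= b * u ^+ 7 by rewrite mulr_ge0 ?exprn_ge0// ltW.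
have hu : 0 <= h ^+ 2 * u ^+ 4 by rewrite mulr_ge0 ?exprn_ge0// ltW.
have : Lam * (h ^+ 2 * u ^+ 4) <= Lam * K * growth_potential b h u.
  rewrite -mulrA ler_wpM2l//; apply: le_trans (_ : growth_potential b h u <= _).
    by rewrite lerDr.
  by rewrite ler_peMl// addr_ge0.
by lra.
Qed.

End Iteration.

(** * One stage of Algorithm B *)

Section Stage.
Variables (R : realType) (d : nat) (F : 'rV[R]_d -> R).
Variables (orc : 'rV[R]_d -> 'rV[R]_d * R) (beta L mu k1 k2 Lam K : R) (xs : 'rV[R]_d).
Hypothesis strongly_convex : forall x y,
  F x + dot (grad F x) (y - x) + mu / 2 * enorm (y - x) ^+ 2 <= F y.
Hypothesis xs_min : forall x, F xs <= F x.
Hypothesis orc_ms : forall z,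
  enorm (grad F (orc z).1 + (orc z).2 *: ((orc z).1 - z))
    <= (orc z).2 / 2 * enorm ((orc z).1 - z).
Hypothesis orc_lam : forall z, (orc z).2 = 2 * beta + L * enorm ((orc z).1 - z).
Hypotheses (mu_gt0 : 0 < mu) (beta_ge0 : 0 <= beta) (L_ge0 : 0 <= L).
Hypothesis betaL : 0 < beta \/ 0 < L.
Hypotheses (Lam_ge1 : 1 <= Lam) (K_ge1 : 1 <= K) (k1_gt0 : 0 < k1).
Hypotheses (Lam_k1 : 4 <= Lam * k1) (K_k2 : 2 * k2 <= K ^+ 2).
Implicit Types (x y z : 'rV[R]_d).

Let tangent x y : F x + dot (grad F x) (y - x) <= F y.
Proof.
apply: le_trans (strongly_convex x y); rewrite lerDl mulr_ge0 ?sqr_ge0//.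
by rewrite divr_ge0// ltW.
Qed.

(** At [p = xs + s *: (x - xs)] the strong convexity inequalities towards [x] and [xs], with weights
    [s] and [1 - s], cancel the gradient. With [F xs <= F p], divide by [s] and let [s] tend to
    0. *)
Lemma quadratic_growth x : mu / 2 * enorm (x - xs) ^+ 2 <= F x - F xs.
Proof.
apply: (@le_of_le_addMr _ _ _ (mu / 2 * enorm (x - xs) ^+ 2)) => s s0 s1.
pose p := xs + s *: (x - xs).
have px : x - p = (1 - s) *: (x - xs) by rewrite opprD addrA scalerBl scale1r.
have pxs : xs - p = (- s) *: (x - xs) by rewrite opprD addrA subrr add0r scaleNr.
have := strongly_convex p x; have := strongly_convex p xs.
rewrite px pxs !enormZ !dotZr !exprMn !real_normK ?num_real//.
have := xs_min p.
move: (dot _ _) (enorm _ ^+ 2) (sqr_ge0 (enorm (x - xs))) => D N N0 h0 h1 h2.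
rewrite -(ler_pM2l s0).
have := ler_wpM2l (ltW s0) h2.
have s1' : 0 <= 1 - s by rewrite subr_ge0.
have := ler_wpM2l s1' h1.
lra.
Qed.

(** If the final weight were below [4 / mu], the potential would be at most 4 times the maximum of
    the two ratios, so [aine_rate] would bound [t] by [64 * Lam * K] times that maximum. The stage
    length is at least twice this and positive, a contradiction. *)
Lemma stage_decrease (C rho : R) (kap : nat -> R) (x0 : 'rV[R]_d) (t : nat) :
  128 * Lam * K <= C -> (forall j, k1 <= kap j <= k2) -> enorm (x0 - xs) <= rho ->
  C * Num.max (Num.sqrt (beta / mu)) ((L * rho / mu) `^ (2 / 7)) <= t%:R ->
  F (aine F orc beta L (rho ^+ 2 / 2) kap x0 t) - F xs <= mu * rho ^+ 2 / 8.
Proof.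
move=> C_ge kap_b x0_rho t_ge.
have rho0 : 0 <= rho := le_trans (enorm_ge0 _) x0_rho.
have LK1 : 1 * 1 <= Lam * K by rewrite ler_pM.
have C0 : 0 < C by lra.
have rhs0 : 0 <= mu * rho ^+ 2 / 8 by rewrite divr_ge0// mulr_ge0 ?sqr_ge0// ltW.
rewrite /aine; case: eqP => [lam0|/eqP lam0].
  (* A zero [lam] makes the returned point stationary, hence a minimiser by the tangent
     inequality. *)
  have := orc_ms x0; rewrite lam0 scale0r addr0 !mul0r => g0.
  have /eqP : enorm (grad F (orc x0).1) = 0 by apply/eqP; rewrite eq_le g0 enorm_ge0.
  rewrite enorm_eq0 => /eqP gE.
  have := tangent (orc x0).1 xs; rewrite gE dot0l addr0; lra.
set s := Num.sqrt _ in t_ge; set r := _ `^ _ in t_ge.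
have s0 : 0 <= s by exact: sqrtr_ge0.
have r0 : 0 <= r by exact: powR_ge0.
have Lrm0 : 0 <= L * rho / mu by rewrite divr_ge0 ?mulr_ge0// ltW.
have s2 : s ^+ 2 = beta / mu by rewrite sqr_sqrtr// divr_ge0// ltW.
have r7 : r ^+ 7 = (L * rho / mu) ^+ 2.
  by rewrite -!powR_mulrn// -powRrM; congr (_ `^ _); field.
have max_s : s <= Num.max s r by rewrite le_max lexx.
have max_r : r <= Num.max s r by rewrite le_max lexx orbT.
(* An empty stage forces both ratios to vanish; [betaL] then gives [rho = 0], so [x0] is already
   [xs]. *)
case: t t_ge => [|t] t_ge.
  have max0 : Num.max s r <= 0 by rewrite -(pmulr_rle0 _ C0).
  have sz : s = 0 by lra.
  have rz : r = 0 by lra.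
  move: s2 r7; rewrite sz rz !expr0n /= => /esym/eqP.
  rewrite mulf_eq0 invr_eq0 (gt_eqF mu_gt0) orbF.
  move=> /eqP bz /esym/eqP; rewrite expf_eq0 /= !mulf_eq0 invr_eq0 (gt_eqF mu_gt0) orbF.
  have -> : (L == 0) = false by case: betaL => [|L0]; [rewrite bz ltxx|rewrite gt_eqF].
  move=> /= /eqP rhoz.
  have : enorm (x0 - xs) = 0 by apply/eqP; rewrite eq_le enorm_ge0 -rhoz x0_rho.
  by move/eqP; rewrite enorm_eq0 subr_eq0 => /eqP ->; rewrite subrr.
have [h h0 h14] : exists2 h, 0 <= h & h ^+ 14 = rho ^+ 2 / 2 * L ^+ 2.
  by apply: root14; rewrite mulr_ge0 ?sqr_ge0// divr_ge0 ?sqr_ge0.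
have close : enorm (x0 - xs) ^+ 2 / 2 <= rho ^+ 2 / 2.
  by rewrite ler_pM2r// lerXn2r ?nnegrE ?enorm_ge0.
have [u [u0 Fle tle]] := aine_rate tangent xs_min orc_ms orc_lam L_ge0 (sqrtr_ge0 _) h0
  (sqr_sqrtr beta_ge0) h14 Lam_ge1 K_ge1 k1_gt0 Lam_k1 K_k2 kap_b close lam0 (ltn0Sn t).
apply: le_trans Fle _.
have U0 : 0 < u ^+ 14 by rewrite exprn_gt0.
have [A_ge|A_lt] := leP (4 / mu) (u ^+ 14).
  rewrite ler_pdivrMr//.
  have -> : rho ^+ 2 / 2 = mu * rho ^+ 2 / 8 * (4 / mu) by field; rewrite gt_eqF.
  by rewrite ler_wpM2l.
exfalso.
set b := Num.sqrt beta in tle.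
have b0 : 0 <= b by exact: sqrtr_ge0.
have bu : b * u ^+ 7 <= 2 * s.
  rewrite -(@ler_pXn2r _ 2) ?nnegrE ?mulr_ge0 ?exprn_ge0// ?(ltW u0)//.
  have -> : (b * u ^+ 7) ^+ 2 = b ^+ 2 * u ^+ 14 by ring.
  have -> : (2 * s) ^+ 2 = b ^+ 2 * (4 / mu).
    by rewrite exprMn s2 /b sqr_sqrtr//; field; rewrite gt_eqF.
  by rewrite ler_wpM2l ?sqr_ge0// ltW.
have hu : h ^+ 2 * u ^+ 4 <= 2 * r.
  rewrite -(@ler_pXn2r _ 7) ?nnegrE ?mulr_ge0 ?exprn_ge0// ?(ltW u0)//.
  have -> : (h ^+ 2 * u ^+ 4) ^+ 7 = h ^+ 14 * (u ^+ 14) ^+ 2 by ring.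
  have -> : (2 * r) ^+ 7 = 128 * r ^+ 7 by ring.
  rewrite r7 h14.
  apply: le_trans (_ : rho ^+ 2 / 2 * L ^+ 2 * (4 / mu) ^+ 2 <= _).
    rewrite ler_wpM2l ?mulr_ge0 ?sqr_ge0 ?divr_ge0 ?sqr_ge0//.
    by rewrite lerXn2r ?nnegrE// ltW// divr_gt0.
  have -> : rho ^+ 2 / 2 * L ^+ 2 * (4 / mu) ^+ 2 = 8 * (L * rho / mu) ^+ 2.
    by field; rewrite gt_eqF.
  by have := sqr_ge0 (L * rho / mu); lra.
have LK : 0 <= Lam * K by lra.
have m0 : 0 <= Num.max s r by lra.
have t1 : 1 <= t.+1%:R :> R by rewrite ler1n.
have h1 : growth_potential b h u <= 4 * Num.max s r by rewrite /growth_potential; lra.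
have := ler_wpM2l LK h1.
have := ler_wpM2r m0 C_ge.
by lra.
Qed.

Lemma stage_halving (C rho : R) (kap : nat -> R) (x0 : 'rV[R]_d) (t : nat) :
  128 * Lam * K <= C -> (forall j, k1 <= kap j <= k2) -> enorm (x0 - xs) <= rho ->
  C * Num.max (Num.sqrt (beta / mu)) ((L * rho / mu) `^ (2 / 7)) <= t%:R ->
  enorm (aine F orc beta L (rho ^+ 2 / 2) kap x0 t - xs) <= rho / 2.
Proof.
move=> C_ge kap_b x0_rho t_ge.
have rho0 : 0 <= rho := le_trans (enorm_ge0 _) x0_rho.
rewrite -(@ler_pXn2r _ 2) ?nnegrE ?enorm_ge0 ?divr_ge0//.
have m2 : 0 < mu / 2 by rewrite divr_gt0.
rewrite -(ler_pM2l m2); apply: le_trans (quadratic_growth _) _.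
apply: le_trans (stage_decrease C_ge kap_b x0_rho t_ge) _.
by rewrite le_eqVlt; apply/orP; left; apply/eqP; field.
Qed.

End Stage.

(** * Counting communication rounds *)

Section Rounds.
Variable R : realType.
Variables (C mu beta L R0 : R).
Hypotheses (C_ge0 : 0 <= C) (mu_gt0 : 0 < mu) (L_ge0 : 0 <= L) (R0_ge0 : 0 <= R0).
Local Notation sqrt_ratio := (Num.sqrt (beta / mu)).
Local Notation pow_ratio := ((L * R0 / mu) `^ (2 / 7)).

Lemma stage_len_bounds s (w : R) :
  w = C * Num.max sqrt_ratio ((L * Defs.radius R0 s.-1 / mu) `^ (2 / 7)) ->
  w <= (stage_len C mu beta L R0 s)%:R <= w + 1.
Proof.
move=> wE; rewrite /stage_len -wE.
have w0 : 0 <= w by rewrite wE mulr_ge0// le_max sqrtr_ge0.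
have /andP[lt_w w_le] := ceil_itv w.
have ceil0 : 0 <= Num.ceil w by rewrite -(ler_int R) (le_trans w0).
rewrite natr_absz (ger0_norm ceil0) w_le /=.
by move: lt_w; rewrite rmorphB /= ltrBlDr => /ltW.
Qed.

(** Compare seventh powers: halving the radius contributes 1/4, and [(6 / 7) ^+ 7 >= 1/4]. *)
Lemma radius_ratio_le s :
  (L * Defs.radius R0 s / mu) `^ (2 / 7) <= pow_ratio * (6 / 7) ^+ s.
Proof.
have pow7 (x : R) : 0 <= x -> (x `^ (2 / 7)) ^+ 7 = x ^+ 2.
  by move=> x0; rewrite -!powR_mulrn ?powR_ge0// -powRrM; congr (_ `^ _); field.
have x0 : 0 <= L * R0 / mu by rewrite divr_ge0 ?mulr_ge0// ltW.
have p2 : 0 < 2 ^+ s :> R by rewrite exprn_gt0.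
have xs0 : 0 <= L * Defs.radius R0 s / mu.
  by rewrite divr_ge0 ?(ltW mu_gt0)// mulr_ge0// divr_ge0// ltW.
have q0 : 0 <= (6 / 7) ^+ s :> R by rewrite exprn_ge0// divr_ge0.
rewrite -(@ler_pXn2r _ 7) ?nnegrE ?powR_ge0//; last by rewrite mulr_ge0// powR_ge0.
rewrite exprMn !pow7//.
have -> : (L * Defs.radius R0 s / mu) ^+ 2 = (L * R0 / mu) ^+ 2 * (4^-1) ^+ s.
  have -> : (4^-1 : R) ^+ s = ((2 ^+ s) ^+ 2)^-1.
    by rewrite exprVn -exprM mulnC exprM; congr (_ ^-1); congr (_ ^+ _); ring.
  by rewrite /Defs.radius; field; rewrite !gt_eqF.
rewrite ler_wpM2l ?sqr_ge0// -exprM mulnC exprM lerXn2r ?nnegrE ?exprn_ge0 ?divr_ge0//.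
by lra.
Qed.

Lemma stage_len_le s : (0 < s)%N ->
  (stage_len C mu beta L R0 s)%:R <= Num.max (1 + C * pow_ratio) (1 + C * sqrt_ratio).
Proof.
case: s => // s _; have /andP[_ le_w] := @stage_len_bounds s.+1 _ erefl.
apply: le_trans le_w _; rewrite /= -addr_maxr -maxr_pMr// addrC lerD2l ler_wpM2l//.
rewrite ge_max !le_max lexx orbT /=; apply/orP; left.
apply: le_trans (radius_ratio_le s) _.
by rewrite ler_piMr ?powR_ge0// exprn_ile1// ?divr_ge0//; lra.
Qed.

Lemma comm_roundsS s : comm_rounds C mu beta L R0 s.+1 =
  (comm_rounds C mu beta L R0 s + 2 * stage_len C mu beta L R0 s.+1)%N.
Proof. by rewrite /comm_rounds big_nat_recr. Qed.

Lemma comm_rounds_le s : (comm_rounds C mu beta L R0 s)%:R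
  <= s%:R * (2 * Num.max (1 + C * pow_ratio) (1 + C * sqrt_ratio)).
Proof.
elim: s => [|s ih]; first by rewrite /comm_rounds big_geq// mul0r.
rewrite comm_roundsS natrD natrM -[s.+1%:R]natr1 [leRHS]mulrDl mul1r lerD//.
by rewrite ler_wpM2l// stage_len_le.
Qed.

(* The radius terms of the stage lengths form a geometric series of ratio 2^(-2/7) <= 6/7. *)
Lemma comm_rounds_geometric s : (comm_rounds C mu beta L R0 s)%:R
  <= 2 * s%:R * (1 + C * sqrt_ratio) + 14 * C * pow_ratio.
Proof.
(* The partial sum of the geometric series makes the induction close; 14 is two rounds per iteration
   times [1 / (1 - 6 / 7)]. *)
suff : (comm_rounds C mu beta L R0 s)%:R <= 2 * s%:R * (1 + C * sqrt_ratio)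
    + 14 * C * pow_ratio * (1 - (6 / 7) ^+ s).
  move=> /le_trans; apply; rewrite lerD2l ler_piMr//.
    by rewrite !mulr_ge0 ?powR_ge0.
elim: s => [|s ih].
  by rewrite /comm_rounds big_geq// mulr0 mul0r expr0 subrr mulr0 addr0.
rewrite comm_roundsS natrD natrM.
have /andP[_ le_w] := @stage_len_bounds s.+1 _ erefl; rewrite /= in le_w.
have max_le : Num.max sqrt_ratio ((L * Defs.radius R0 s / mu) `^ (2 / 7))
    <= sqrt_ratio + pow_ratio * (6 / 7) ^+ s.
  have sq0 : 0 <= sqrt_ratio by exact: sqrtr_ge0.
  have p0 : 0 <= (L * Defs.radius R0 s / mu) `^ (2 / 7) by exact: powR_ge0.
  have := radius_ratio_le s.
  by rewrite ge_max; move=> le_p; apply/andP; split; lra.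
have := ler_wpM2l C_ge0 max_le.
rewrite exprSr -[s.+1%:R]natr1.
by move: ih le_w; lra.
Qed.

End Rounds.

(** * Choice of the constants, then distances, budget and complexity *)

Theorem corollary1 (R : realType) (kap1 kap2 : R)
    (kap1_gt0 : 0 < kap1) (kap12 : kap1 <= kap2) :
  exists2 C0 : R, 0 < C0 &
  forall C : R, C0 <= C ->
  exists2 K : R, 0 < K &
  forall (d m n : nat) (m_gt0 : (0 < m)%N) (n_gt0 : (0 < n)%N)
         (Xi : Type) (f : 'rV[R]_d -> Xi -> R) (xi : 'I_m -> 'I_n -> Xi)
         (L0 L mu beta R0 : R) (xbar xstar z0 : 'rV[R]_d)
         (orc : 'rV[R]_d -> 'rV[R]_d * R) (kap : nat -> nat -> R),
  let F := objective f xi mu xbar in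
  let z := restarted_aine F orc C mu beta L R0 kap z0 in
  let tau1 := 1 + C * (L * R0 / mu) `^ (2 / 7) in
  let tau2 := 1 + C * Num.sqrt (beta / mu) in
  let nstages (T : nat) := Num.truncn (T%:R / (2 * Num.max tau1 tau2)) in
  (forall w : Xi, regular_loss L0 L (f^~ w)) ->
  0 < mu -> 0 <= L -> 0 <= beta -> 0 < beta \/ 0 < L ->
  similarity_bound f xi beta ->
  (forall x, F xstar <= F x) ->
  cubic_oracle F (server_hess f xi mu (Ordinal m_gt0)) beta L orc ->
  (forall s j, kap1 <= kap s j <= kap2) ->
  enorm (z0 - xstar) <= R0 ->
  [/\ forall s : nat, enorm (z s - xstar) <= R0 / 2 ^+ s,
      forall s : nat, (0 < s)%N ->
        F (z s) - F xstar <= mu * R0 ^+ 2 / 2 / 2 ^+ (2 * s),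
      forall T : nat,
        (comm_rounds C mu beta L R0 (nstages T) <= T)%N /\
        enorm (z (nstages T) - xstar)
          <= 2 * R0 * expR (- (ln 2 * T%:R / (2 * Num.max tau1 tau2)))
    & forall eps : R, 0 < eps -> eps <= mu * R0 ^+ 2 / 2 ->
        exists s : nat,
          F (z s) - F xstar <= eps /\
          (comm_rounds C mu beta L R0 s)%:R
            <= K * ((L * R0 / mu) `^ (2 / 7)
                    + (1 + Num.sqrt (beta / mu)) * ln (mu * R0 ^+ 2 / eps))].
Proof.
(* Chosen so that [4 <= Lam * kap1] and [2 * kap2 <= K ^+ 2]; they depend only on the constants
   hidden in the Theta of the guess. *)
pose Lam := 1 + 4 / kap1; pose K := 1 + kap2.
have kap2_gt0 : 0 < kap2 := lt_le_trans kap1_gt0 kap12.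
have Lam1 : 1 <= Lam by rewrite lerDl divr_ge0// ltW.
have K1 : 1 <= K by rewrite lerDl ltW.
have Lamk1 : 4 <= Lam * kap1.
  by rewrite mulrDl mul1r divfK ?gt_eqF// lerDr ltW.
have Kk2 : 2 * kap2 <= K ^+ 2 by rewrite /K; have := sqr_ge0 kap2; lra.
have LK1 : 1 * 1 <= Lam * K by rewrite ler_pM.
exists (128 * Lam * K); first by lra.
move=> C C_ge.
have C1 : 1 <= C by lra.
have C_ge0 : 0 <= C by lra.
have ln2 : 0 < ln 2 :> R by rewrite ln_gt0// ltr1n.
(* [14 * C] covers the geometric part; [4 * C / ln 2] comes from two rounds per iteration and at
   most [2 * (ln X / ln 2)] stages, with [X = mu * R0 ^+ 2 / eps]. *)
exists (14 * C + 4 * C / ln 2).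
  by rewrite addr_gt0 ?divr_gt0 ?mulr_gt0//; lra.
move=> d m n m_gt0 n_gt0 Xi f xi L0 L mu beta R0 xbar xstar z0 orc kap F z tau1 tau2 nstages.
move=> f_reg mu_gt0 L_ge0 beta_ge0 betaL sim xmin orcE kapE z0_R0.
have R0_ge0 : 0 <= R0 := le_trans (enorm_ge0 _) z0_R0.
have sc := objective_strongly_convex xi mu xbar m_gt0 n_gt0 f_reg.
have orc_lam x : (orc x).2 = 2 * beta + L * enorm ((orc x).1 - x) by have [] := orcE x.
have orc_ms x : enorm (grad F (orc x).1 + (orc x).2 *: ((orc x).1 - x))
    <= (orc x).2 / 2 * enorm ((orc x).1 - x).
  have [ymin lamE] := orcE x.
  apply: cubic_step_monteiro_svaiter ymin lamE => //.
    by move=> u v; exact: (server_hess_sym xi mu n_gt0 f_reg).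
  exact: (objective_inexact_taylor mu xbar m_gt0 n_gt0 f_reg _ _ _ L_ge0 sim).
have t_ge s := proj1 (andP (@stage_len_bounds _ C mu beta L R0 C_ge0 s _ erefl)).
have dist s : enorm (z s - xstar) <= Defs.radius R0 s.
  elim: s => [|s ih]; first by rewrite /Defs.radius expr0 divr1.
  have -> : Defs.radius R0 s.+1 = Defs.radius R0 s / 2.
    by rewrite /Defs.radius exprSr; field; rewrite expf_neq0.
  exact: (stage_halving sc xmin orc_ms orc_lam mu_gt0 beta_ge0 L_ge0 betaL Lam1 K1
    kap1_gt0 Lamk1 Kk2 C_ge (kapE s.+1) ih (t_ge s.+1)).
have gap s : (0 < s)%N -> F (z s) - F xstar <= mu * R0 ^+ 2 / 2 / 2 ^+ (2 * s).
  case: s => // s _.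
  apply: le_trans (stage_decrease sc xmin orc_ms orc_lam mu_gt0 beta_ge0 L_ge0 betaL Lam1 K1
    kap1_gt0 Lamk1 Kk2 C_ge (kapE s.+1) (dist s) (t_ge s.+1)) _.
  rewrite /Defs.radius mulnC exprM (exprSr 2 s) le_eqVlt; apply/orP; left; apply/eqP.
  by field; rewrite expf_neq0.
have tau1_ge1 : 1 <= tau1 by rewrite lerDl mulr_ge0// powR_ge0.
have tau_ge1 : 1 <= Num.max tau1 tau2 by rewrite le_max tau1_ge1.
have tau2_gt0 : 0 < 2 * Num.max tau1 tau2 by lra.
split=> // [T|eps eps0 eps_le].
  have x0 : 0 <= T%:R / (2 * Num.max tau1 tau2) by rewrite divr_ge0// ltW.
  have /andP[S_le S_gt] := truncn_itv x0; rewrite -/(nstages T) in S_le S_gt.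
  split.
    rewrite -(ler_nat R); apply: le_trans (comm_rounds_le beta C_ge0 mu_gt0 L_ge0 R0_ge0 _) _.
    by rewrite -ler_pdivlMr.
  apply: le_trans (dist _) _; rewrite /Defs.radius (mulrC 2 R0) -(mulrA R0) ler_wpM2l//.
  set S := nstages T in S_gt *; set x := T%:R / _ in S_gt *.
  have -> : ln 2 * T%:R / (2 * Num.max tau1 tau2) = x * ln 2 by rewrite -mulrA mulrC.
  (* Rounding down loses less than one stage, [x < S.+1], and one stage is the factor 2 in front of
     [R0]. *)
  have : expR (- (S.+1%:R * ln 2)) <= expR (- (x * ln 2)).
    by rewrite ler_expR lerN2 ler_wpM2r// ltW.
  rewrite expRN expRM_natl lnK ?posrE// exprS invfM => h.
  by have := ler_wpM2l (ler0n _ 2) h; rewrite mulrA mulfV ?mul1r.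
set X := mu * R0 ^+ 2 / eps.
(* The upper bound on [eps] makes the logarithm at least [ln 2], so that the extra stage from
   rounding up can be absorbed. *)
have X2 : 2 <= X by rewrite ler_pdivlMr// mulrC -ler_pdivlMr.
have X0 : 0 < X by lra.
have lnX : ln 2 <= ln X by rewrite ler_ln ?posrE.
have w0 : 0 <= ln X / ln 2 by rewrite divr_ge0// ltW//; lra.
have /andP[S_le S_gt] := truncn_itv w0.
(* This many stages give [X <= 2 ^+ S.+1]; the gap shrinks by 4 per stage, so about half would do,
   at the cost of a constant only. *)
exists (Num.truncn (ln X / ln 2)).+1; set S := Num.truncn _ in S_le S_gt *; clearbody S.
have X_le : X <= 2 ^+ S.+1.
  rewrite -ler_ln ?posrE ?exprn_gt0// lnXn// -[leRHS]mulr_natl -ler_pdivrMr//.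
  exact: ltW.
split.
  apply: le_trans (gap _ (ltn0Sn _)) _.
  have p1 : 1 <= 2 ^+ S.+1 :> R by rewrite exprn_ege1// ler1n.
  have p4 : X <= 2 ^+ (2 * S.+1).
    by apply: le_trans X_le _; rewrite mul2n -addnn exprD ler_peMl//; lra.
  rewrite ler_pdivrMr ?exprn_gt0// [leRHS]mulrC.
  have := ler_wpM2r (ltW eps0) p4; rewrite /X divfK ?gt_eqF//.
  have : 0 <= mu * R0 ^+ 2 by rewrite mulr_ge0 ?sqr_ge0// ltW.
  by move=> q0 /(le_trans _); apply; rewrite ler_pdivrMr// ler_peMr// ler1n.
apply: le_trans (comm_rounds_geometric beta C_ge0 mu_gt0 L_ge0 R0_ge0 _) _.
have s0 : 0 <= Num.sqrt (beta / mu) by exact: sqrtr_ge0.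
have p0 : 0 <= (L * R0 / mu) `^ (2 / 7) by exact: powR_ge0.
have S1 : S.+1%:R <= 2 * (ln X / ln 2).
  have : 1 <= ln X / ln 2 by rewrite ler_pdivlMr// mul1r.
  by rewrite mulr_natl mulr2n -[S.+1%:R]natr1; exact: lerD.
have C_sqrt : 1 + C * Num.sqrt (beta / mu) <= C * (1 + Num.sqrt (beta / mu)).
  by rewrite mulrDr mulr1 lerD2r.
have Cs0 : 0 <= 1 + C * Num.sqrt (beta / mu) by rewrite addr_ge0 ?mulr_ge0.
have extra1 : 0 <= 4 * C / ln 2 * (L * R0 / mu) `^ (2 / 7).
  by rewrite mulr_ge0// divr_ge0 ?mulr_ge0// ltW.
have extra2 : 0 <= C * ((1 + Num.sqrt (beta / mu)) * ln X).
  rewrite mulr_ge0// mulr_ge0 ?addr_ge0//.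
  exact: le_trans (ltW ln2) lnX.
have key : 2 * S.+1%:R * (1 + C * Num.sqrt (beta / mu))
    <= 4 * C / ln 2 * ((1 + Num.sqrt (beta / mu)) * ln X).
  have -> : 4 * C / ln 2 * ((1 + Num.sqrt (beta / mu)) * ln X)
    = 2 * (2 * (ln X / ln 2) * (C * (1 + Num.sqrt (beta / mu)))) by ring.
  by rewrite -[leLHS]mulrA ler_pM2l//; exact: ler_pM.
apply: le_trans (lerD key (lexx _)) _.
move: extra1 extra2; clear.
move: ((L * R0 / mu) `^ (2 / 7)) (Num.sqrt (beta / mu)) (ln X) (ln (2 : R)) => p q l l2.
by lra.
Qed.
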